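(* Let $\Phi\subset\mathbb{R}^3$ be a ruled $C^3$-surface, free of torsal rulings, which is relatively normalized by ${}^{(\alpha)}\bar y$ with $\alpha\in\mathbb{R}\setminus\{1/4\}$. The following properties are equivalent: (i) The Tchebychev vectors ${}^{(\alpha)}\bar T$ are tangent to the curved asymptotic lines, or to the curves of constant striction distance, or to the $K$-curves of $\Phi$. (ii) The Pick invariant ${}^{(\alpha)}J$ vanishes identically. (iii) $\Phi$ lies on a right helicoid.
   Context: Ruled surfaces. Let $I\subset\mathbb{R}$ be an open interval and $U=I\times\mathbb{R}$. A ruled surface $\Phi$ free of torsal rulings is parametrized over $U$ by the (injective) immersion $\bar x(u,v)=\bar s(u)+v\,\bar e(u)$ with $|\bar e|=|\bar e'|=1$ and $\langle\bar s',\bar e'\rangle=0$ on $I$ (so $\bar s$ is the line of striction, $u$ is arc length of the spherical curve $\bar e$); a prime denotes $d/du$. For a $C^3$-surface $\bar s,\bar e$ are of class $C^3$. The moving frame is $\bar e$, $\bar n=\bar e'$, $\bar z=\bar e\times\bar n$. The fundamental invariants are: conical curvature $\kappa=\det(\bar e,\bar e',\bar e'')$, parameter of distribution $\delta=\det(\bar s',\bar e,\bar e')$, and $\lambda$, defined by $\bar s'=\delta(\lambda\bar e+\bar z)$. Free of torsal rulings (skew) means $\delta(u)\ne0$ for all $u\in I$. In terms of these invariants, $\Phi$ lies on a right helicoid exactly when $\kappa=\lambda=\delta'=0$ on $I$. Relative normalization. Put $u^1=u$, $u^2=v$. Let $\bar\xi=(\bar x_u\times\bar x_v)/|\bar x_u\times\bar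 x_v|$ be the Euclidean unit normal, $h_{ij}=\langle\bar\xi,\partial^2\bar x/\partial u^i\partial u^j\rangle$ the second fundamental form with inverse $h^{(ij)}$, and $K$ the Gaussian curvature ($K=-\delta^2/(v^2+\delta^2)^2\neq0$). For $\alpha\in\mathbb{R}$ put $q={}^{(\alpha)}q=|K|^\alpha$ (support function); the relative normalization it determines is ${}^{(\alpha)}\bar y=-h^{(ij)}\frac{\partial q}{\partial u^i}\frac{\partial\bar x}{\partial u^j}+q\,\bar\xi$ (summation over repeated indices). The relative metric is $G_{ij}=q^{-1}h_{ij}$, with inverse $G^{ij}$; indices are raised and lowered with $G$. The symmetric Darboux tensor is $$A_{jkl}=\frac1q\Big\langle\bar\xi,\frac{\partial^3\bar x}{\partial u^j\partial u^k\partial u^l}\Big\rangle-\frac12\Big(\frac{\partial G_{jk}}{\partial u^l}+\frac{\partial G_{kl}}{\partial u^j}+\frac{\partial G_{lj}}{\partial u^k}\Big).$$ The Tchebychev vector is ${}^{(\alpha)}\bar T=T^i\,\partial\bar x/\partial u^i$ with $T_i=\frac12A_{ijk}G^{jk}$, $T^i=G^{ij}T_j$, and the Pick invariant is ${}^{(\alpha)}J=\frac12A_{jkl}A^{jkl}$. Curves. The curved asymptotic lines are the asymptotic lines other than the rulings. The curves of constant striction distance are the curves $v=\text{const}$ ($u$-curves). The $K$-curves are the curves along which $K$ is constant. ''The Tchebychev vectors are tangent to a family of curves'' means that at every point $(u,v)\in U$ the vector ${}^{(\alpha)}\bar T(u,v)$ (possibly zero) is tangent to the curve of the family through that point; for the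 $K$-curves this means $dK({}^{(\alpha)}\bar T)=0$ everywhere. *)

(* Defs.v *)
(* Real analysis over Stdlib's R, with Coquelicot's total derivatives. *)
From Stdlib Require Import Reals Lra.
From Coquelicot Require Import Coquelicot.
Open Scope R_scope.

Definition R3 : Type := (R * R * R)%type.
Definition c1 (p : R3) : R := fst (fst p).
Definition c2 (p : R3) : R := snd (fst p).
Definition c3 (p : R3) : R := snd p.

Definition vzero : R3 := (0, 0, 0).
Definition vadd (p q : R3) : R3 := (c1 p + c1 q, c2 p + c2 q, c3 p + c3 q).
Definition vscal (r : R) (p : R3) : R3 := (r * c1 p, r * c2 p, r * c3 p).
Definition dot (p q : R3) : R := c1 p * c1 q + c2 p * c2 q + c3 p * c3 q.
Definition vnorm (p : R3) : R := sqrt (dot p p).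
Definition cross (p q : R3) : R3 :=
  (c2 p * c3 q - c3 p * c2 q,
   c3 p * c1 q - c1 p * c3 q,
   c1 p * c2 q - c2 p * c1 q).
Definition det3 (p q r : R3) : R := dot (cross p q) r.

Definition in_interval (a b : Rbar) (u : R) : Prop := Rbar_lt a u /\ Rbar_lt u b.

Definition vDerive (c : R -> R3) (t : R) : R3 :=
  (Derive (fun w => c1 (c w)) t,
   Derive (fun w => c2 (c w)) t,
   Derive (fun w => c3 (c w)) t).

Definition class_C (n : nat) (I : R -> Prop) (f : R -> R) : Prop :=
  forall t, I t ->
    (forall k, (k <= n)%nat -> ex_derive_n f k t) /\
    continuous (Derive_n f n) t.

Definition vclass_C (n : nat) (I : R -> Prop) (c : R -> R3) : Prop :=
  class_C n I (fun t => c1 (c t)) /\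
  class_C n I (fun t => c2 (c t)) /\
  class_C n I (fun t => c3 (c t)).

(* The parameter index: i1 stands for u^1 = u and i2 for u^2 = v. *)
Inductive idx : Set := i1 | i2.
Definition sum2 (f : idx -> R) : R := f i1 + f i2.
Definition mat2 : Type := idx -> idx -> R.
Definition det2 (m : mat2) : R := m i1 i1 * m i2 i2 - m i1 i2 * m i2 i1.
Definition inv2 (m : mat2) : mat2 := fun i j =>
  match i, j with
  | i1, i1 => m i2 i2 / det2 m
  | i1, i2 => - m i1 i2 / det2 m
  | i2, i1 => - m i2 i1 / det2 m
  | i2, i2 => m i1 i1 / det2 m
  end.

Definition pd (i : idx) (f : R -> R -> R) (u v : R) : R :=
  match i with
  | i1 => Derive (fun t => f t v) u
  | i2 => Derive (fun t => f u t) v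
  end.
Definition vpd (i : idx) (x : R -> R -> R3) (u v : R) : R3 :=
  match i with
  | i1 => vDerive (fun t => x t v) u
  | i2 => vDerive (fun t => x u t) v
  end.

(** * Euclidean geometry of a parametrized surface *)

Definition unit_normal (x : R -> R -> R3) (u v : R) : R3 :=
  let w := cross (vpd i1 x u v) (vpd i2 x u v) in vscal (/ vnorm w) w.

Definition first_form (x : R -> R -> R3) (u v : R) : mat2 := fun i j =>
  dot (vpd i x u v) (vpd j x u v).

Definition second_form (x : R -> R -> R3) (u v : R) : mat2 := fun i j =>
  dot (unit_normal x u v) (vpd i (vpd j x) u v).

Definition gauss_curvature (x : R -> R -> R3) (u v : R) : R :=
  det2 (second_form x u v) / det2 (first_form x u v).

(* The tangent vector w^1 x_u + w^2 x_v with contravariant components w. *)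
Definition push (x : R -> R -> R3) (u v : R) (w : idx -> R) : R3 :=
  vadd (vscal (w i1) (vpd i1 x u v)) (vscal (w i2) (vpd i2 x u v)).

(** * Relative geometry *)

(* The relative normalization determined by the support function q. *)
Definition normalization (x : R -> R -> R3) (q : R -> R -> R) (u v : R) : R3 :=
  vadd
    (push x u v (fun j =>
       - sum2 (fun i => inv2 (second_form x u v) i j * pd i q u v)))
    (vscal (q u v) (unit_normal x u v)).

Definition manhart_support (x : R -> R -> R3) (alpha u v : R) : R :=
  Rpower (Rabs (gauss_curvature x u v)) alpha.

Definition manhart_normalization (x : R -> R -> R3) (alpha : R) : R -> R -> R3 :=
  normalization x (manhart_support x alpha).

(* A relative normalization y enters the relative metric and the Darboux tensor
   through its support function <xi, y> only; support_normalization below shows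
   that for [normalization x q] this is q again. *)
Definition support (x y : R -> R -> R3) (u v : R) : R :=
  dot (unit_normal x u v) (y u v).

Definition relative_metric (x y : R -> R -> R3) (u v : R) : mat2 := fun i j =>
  / support x y u v * second_form x u v i j.

Definition relative_metric_inv (x y : R -> R -> R3) (u v : R) : mat2 :=
  inv2 (relative_metric x y u v).

Definition darboux (x y : R -> R -> R3) (u v : R) (j k l : idx) : R :=
  / support x y u v * dot (unit_normal x u v) (vpd j (vpd k (vpd l x)) u v)
  - 1 / 2 * (pd l (fun s t => relative_metric x y s t j k) u v
             + pd j (fun s t => relative_metric x y s t k l) u v
             + pd k (fun s t => relative_metric x y s t l j) u v).

Definition darboux_up (x y : R -> R -> R3) (u v : R) (j k l : idx) : R :=
  let Gi := relative_metric_inv x y u v in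
  sum2 (fun m => sum2 (fun n => sum2 (fun p =>
    Gi j m * Gi k n * Gi l p * darboux x y u v m n p))).

Definition tchebychev_low (x y : R -> R -> R3) (u v : R) (i : idx) : R :=
  1 / 2 * sum2 (fun j => sum2 (fun k =>
    darboux x y u v i j k * relative_metric_inv x y u v j k)).

Definition tchebychev_up (x y : R -> R -> R3) (u v : R) (i : idx) : R :=
  sum2 (fun j => relative_metric_inv x y u v i j * tchebychev_low x y u v j).

Definition tchebychev (x y : R -> R -> R3) (u v : R) : R3 :=
  push x u v (tchebychev_up x y u v).

Definition pick (x y : R -> R -> R3) (u v : R) : R :=
  1 / 2 * sum2 (fun j => sum2 (fun k => sum2 (fun l =>
    darboux x y u v j k l * darboux_up x y u v j k l))).

(** * Ruled surfaces *)

Definition ruled (s e : R -> R3) (u v : R) : R3 := vadd (s u) (vscal v (e u)).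

(* delta = det (s', e, e') *)
Definition distribution (s e : R -> R3) (u : R) : R :=
  det3 (vDerive s u) (e u) (vDerive e u).

(* A ruled C^3-surface free of torsal rulings, over ]a, b[ x R, referred to its
   line of striction s and to the arc length u of the spherical curve e. *)
Record skew_ruled_surface (a b : Rbar) (s e : R -> R3) : Prop := {
  srs_interval : Rbar_lt a b;
  srs_C3_s : vclass_C 3 (in_interval a b) s;
  srs_C3_e : vclass_C 3 (in_interval a b) e;
  srs_unit : forall u, in_interval a b u -> vnorm (e u) = 1;
  srs_arclength : forall u, in_interval a b u -> vnorm (vDerive e u) = 1;
  srs_striction : forall u, in_interval a b u ->
    dot (vDerive s u) (vDerive e u) = 0;
  srs_skew : forall u, in_interval a b u -> distribution s e u <> 0;
  srs_immersion : forall u v, in_interval a b u ->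
    cross (vpd i1 (ruled s e) u v) (vpd i2 (ruled s e) u v) <> vzero;
  srs_injective : forall u v u' v', in_interval a b u -> in_interval a b u' ->
    ruled s e u v = ruled s e u' v' -> u = u' /\ v = v'
}.

(** * Tangency to families of curves *)

(* An asymptotic line of x, given in the parameter plane by t |-> (cu t, cv t)
   for |t| < r, other than a ruling. The rulings u = const are themselves
   asymptotic lines, and on a skew ruled surface the second asymptotic direction
   is transversal to the ruling at every point; hence [Derive cu t <> 0], which
   also makes the curve regular. *)
Definition curved_asymptotic_line (a b : Rbar) (x : R -> R -> R3)
    (r : R) (cu cv : R -> R) : Prop :=
  let vel t i := match i with i1 => Derive cu t | i2 => Derive cv t end in
  forall t, Rabs t < r ->
    in_interval a b (cu t) /\
    ex_derive cu t /\ ex_derive cv t /\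
    continuous (Derive cu) t /\ continuous (Derive cv) t /\
    sum2 (fun i => sum2 (fun j =>
      second_form x (cu t) (cv t) i j * vel t i * vel t j)) = 0 /\
    Derive cu t <> 0.

(* A vector, possibly zero, is tangent to a curve if it is a multiple of its
   velocity. *)
Definition tangent_curved_asymptotic_lines (a b : Rbar) (x : R -> R -> R3)
    (T : R -> R -> R3) : Prop :=
  forall u v, in_interval a b u ->
    exists (r : R) (cu cv : R -> R),
      0 < r /\ curved_asymptotic_line a b x r cu cv /\
      cu 0 = u /\ cv 0 = v /\
      exists k : R, T u v =
        vscal k (push x u v (fun i =>
          match i with i1 => Derive cu 0 | i2 => Derive cv 0 end)).

(* The curves v = const have velocity x_u. *)
Definition tangent_striction_distance_curves (a b : Rbar) (x : R -> R -> R3)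
    (T : R -> R -> R3) : Prop :=
  forall u v, in_interval a b u ->
    exists k : R, T u v = vscal k (vpd i1 x u v).

(* dK(T) = 0, for the tangent field T with contravariant components T^i. *)
Definition tangent_K_curves (a b : Rbar) (x : R -> R -> R3)
    (T : R -> R -> idx -> R) : Prop :=
  forall u v, in_interval a b u ->
    sum2 (fun i => T u v i * pd i (gauss_curvature x) u v) = 0.

(** * Right helicoids *)

(* The right helicoid with axis p + R n and reduced pitch k: the ruling at
   height k * phi points in the direction cos phi * l + sin phi * m. *)
Definition right_helicoid (p l m n : R3) (k : R) (z : R3) : Prop :=
  exists r phi : R,
    z = vadd p (vadd (vscal (r * cos phi) l)
                     (vadd (vscal (r * sin phi) m) (vscal (k * phi) n))).

Definition orthonormal (l m n : R3) : Prop :=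
  dot l l = 1 /\ dot m m = 1 /\ dot n n = 1 /\
  dot l m = 0 /\ dot l n = 0 /\ dot m n = 0.

Definition lies_on_right_helicoid (a b : Rbar) (x : R -> R -> R3) : Prop :=
  exists (p l m n : R3) (k : R),
    orthonormal l m n /\ k <> 0 /\
    forall u v, in_interval a b u -> right_helicoid p l m n k (x u v).

Lemma support_normalization (x : R -> R -> R3) (q : R -> R -> R) (u v : R) :
  cross (vpd i1 x u v) (vpd i2 x u v) <> vzero ->
  support x (normalization x q) u v = q u v.
Proof.
  intros Hw.
  unfold support, normalization.
  set (w := fun j => - sum2 _). clearbody w.
  unfold push, unit_normal.
  set (P := vpd i1 x u v) in *. set (Q := vpd i2 x u v) in *.
  clearbody P Q.
  assert (Hpos : 0 < dot (cross P Q) (cross P Q)).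
  { destruct (Rle_lt_or_eq_dec 0 (dot (cross P Q) (cross P Q))) as [H | H]; auto.
    - unfold dot. pose proof (Rle_0_sqr (c1 (cross P Q))) as H1.
      pose proof (Rle_0_sqr (c2 (cross P Q))) as H2.
      pose proof (Rle_0_sqr (c3 (cross P Q))) as H3.
      unfold Rsqr in *; lra.
    - exfalso; apply Hw. unfold dot in H.
      destruct (cross P Q) as [[X Y] Z]; unfold c1, c2, c3, vzero in *; simpl in *.
      pose proof (Rle_0_sqr X) as H1. pose proof (Rle_0_sqr Y) as H2.
      pose proof (Rle_0_sqr Z) as H3. unfold Rsqr in *.
      assert (X = 0) by (apply Rsqr_0_uniq; unfold Rsqr; lra).
      assert (Y = 0) by (apply Rsqr_0_uniq; unfold Rsqr; lra).
      assert (Z = 0) by (apply Rsqr_0_uniq; unfold Rsqr; lra).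
      congruence. }
  assert (Hn : vnorm (cross P Q) * vnorm (cross P Q) = dot (cross P Q) (cross P Q))
    by (apply sqrt_sqrt; lra).
  assert (Hn0 : vnorm (cross P Q) <> 0) by (intro H; rewrite H in Hn; lra).
  set (N := vnorm (cross P Q)) in *. clearbody N.
  transitivity (q u v * (/ N * / N * dot (cross P Q) (cross P Q))).
  - unfold dot, vadd, vscal, cross, c1, c2, c3; simpl; ring.
  - rewrite <- Hn; field; exact Hn0.
Qed.

(* Main.v *)
Require Import Defs.
From Stdlib Require Import Reals Lra Lia.
From Coquelicot Require Import Coquelicot.
(* Reals also has a projection [c1]: the coordinate must shadow it. *)
Import Defs.
Open Scope R_scope.

(** Everything reduces to one cubic polynomial in [v]. In the orthonormal frame
    [e], [n = e'], [z = e * n] of the ruled surface, put [d] for the parameter of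
    distribution, [k] for the conical curvature, [p = <s', e> = d * lambda] and
    [W = v^2 + d^2]. The coefficients of the second fundamental form are
    [- N / sqrt W], [d / sqrt W] and [0], where [N = k * W + d' * v - d * p].

    The rulings are null lines of the relative metric [G], so [G^11 = 0]; with
    [A_222 = 0] this removes [A_111] from both the Tchebychev vector and the Pick
    invariant ([null_coordinate_invariants]). That is why third derivatives of
    [s] and [e] never appear. The remaining values of the Darboux tensor,
    [A_122] and [A_112], are elementary and both carry the factor [4 * alpha - 1]:
    in [A_112] all other terms cancel ([darboux_112]). Hence
    ([ruled_invariants]), up to factors without zeros, the Pick invariant is
    [v * (d' * (v^2 - d^2) - v * N)] and [T^1], [T^2] are [v] and
    [d' * (v^2 - d^2) - 2 * v * N].

    Substituted into each of the three tangency conditions, these components give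
    [d' * (v^2 - d^2) - c * v * N = 0] for all [v <> 0], with [c = 1] or [c = 2],
    and the vanishing of the Pick invariant gives the same with [c = 1]. This is
    a cubic polynomial in [v], whose coefficients vanish exactly when
    [k = p = d' = 0] ([helicoidal_of_vanishing]). Conversely these equations make
    [T^2] and the Pick invariant zero.

    It remains to match [k = p = d' = 0] with right helicoids. If the equations
    hold, the frame rotates with unit speed about the constant vector [z] while
    [s] moves along [z] with constant speed [d] ([helicoid_of_helicoidal]). If
    the surface lies on a right helicoid, its rulings are horizontal, because the
    only other line on a helicoid is the axis; comparing the angle of a ruling
    with its height then determines the three invariants
    ([helicoidal_of_helicoid]). *)

(** * Vector algebra *)

Ltac vec_unfold :=
  repeat match goal with p : R3 |- _ => destruct p as [[? ?] ?] end;
  unfold det3, dot, cross, vadd, vscal, vzero, c1, c2, c3; cbn [fst snd].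
Ltac split3 := split; [| split].
Ltac vec_ring :=
  intros; vec_unfold;
  try match goal with |- (_, _, _) = _ => f_equal; [f_equal |] end; ring.

Lemma R3_ext (p q : R3) : c1 p = c1 q -> c2 p = c2 q -> c3 p = c3 q -> p = q.
Proof. destruct p as [[? ?] ?], q as [[? ?] ?]; unfold c1, c2, c3; simpl; congruence. Qed.

Lemma dot_sym (p q : R3) : dot p q = dot q p.
Proof. vec_ring. Qed.

Lemma vnorm_1_dot (p : R3) : vnorm p = 1 -> dot p p = 1.
Proof.
  unfold vnorm; intros H.
  rewrite <- (sqrt_sqrt (dot p p)); [rewrite H; ring |].
  vec_unfold; nra.
Qed.

(** With [z] the cross product of [E] and [N], the double cross product rule
    evaluates the iterated product of [z], [z] and [V] in two ways: from the
    outside as a combination of [z] and [V], from the inside as a combination of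
    [E] and [N]. Comparing the two shows that the frame is complete. *)
Lemma frame_decomposition (E N V : R3) :
  dot E E = 1 -> dot N N = 1 -> dot E N = 0 ->
  V = vadd (vscal (dot V E) E)
        (vadd (vscal (dot V N) N) (vscal (dot V (cross E N)) (cross E N))).
Proof.
  intros HE HN HEN.
  assert (Hz : dot (cross E N) (cross E N) = 1).
  { transitivity (dot E E * dot N N - dot E N * dot E N); [vec_ring |].
    rewrite HE, HN, HEN; ring. }
  set (z := cross E N) in *.
  transitivity (vscal (dot z z) V).
  { rewrite Hz; vec_ring. }
  transitivity (vadd (vscal (dot E E * dot V N - dot E N * dot V E) N)
    (vadd (vscal (dot N N * dot V E - dot E N * dot V N) E)
       (vscal (dot V z) z))).
  { unfold z; vec_ring. }
  rewrite HE, HN, HEN; vec_ring.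
Qed.

(** * Derivatives of curves and of surfaces *)

Definition is_vderive (c : R -> R3) (t : R) (d : R3) : Prop :=
  is_derive (fun w => c1 (c w)) t (c1 d) /\
  is_derive (fun w => c2 (c w)) t (c2 d) /\
  is_derive (fun w => c3 (c w)) t (c3 d).

Lemma is_vderive_unique c t d : is_vderive c t d -> vDerive c t = d.
Proof.
  intros (H1 & H2 & H3); unfold vDerive.
  apply R3_ext; apply is_derive_unique; assumption.
Qed.

Lemma is_vderive_ext_loc c d t l :
  locally t (fun w => c w = d w) -> is_vderive c t l -> is_vderive d t l.
Proof.
  intros H (H1 & H2 & H3); split3;
    (eapply is_derive_ext_loc; [| eassumption]); simpl;
    eapply filter_imp; try exact H; intros w Hw; now rewrite Hw.
Qed.

Lemma is_vderive_const p t : is_vderive (fun _ => p) t vzero.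
Proof. split3; apply @is_derive_const. Qed.

Lemma is_vderive_add c d t lc ld :
  is_vderive c t lc -> is_vderive d t ld ->
  is_vderive (fun w => vadd (c w) (d w)) t (vadd lc ld).
Proof.
  intros (H1 & H2 & H3) (G1 & G2 & G3).
  split3; apply @is_derive_plus; assumption.
Qed.

Lemma is_derive_Rmult f g t lf lg :
  is_derive f t lf -> is_derive g t lg ->
  is_derive (fun w => f w * g w) t (lf * g t + f t * lg).
Proof. intros; apply @is_derive_mult; auto; intros; apply Rmult_comm. Qed.

Lemma is_derive_Rplus f g t lf lg :
  is_derive f t lf -> is_derive g t lg ->
  is_derive (fun w => f w + g w) t (lf + lg).
Proof. intros; apply @is_derive_plus; auto. Qed.

Lemma is_derive_Rminus f g t lf lg :
  is_derive f t lf -> is_derive g t lg ->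
  is_derive (fun w => f w - g w) t (lf - lg).
Proof. intros; apply @is_derive_minus; auto. Qed.

Lemma is_derive_eq (f : R -> R) t (l l' : R) :
  is_derive f t l -> l = l' -> is_derive f t l'.
Proof. now intros H <-. Qed.

Lemma is_vderive_eq f t l l' : is_vderive f t l -> l = l' -> is_vderive f t l'.
Proof. now intros H <-. Qed.

Lemma is_vderive_scal f c t lf lc :
  is_derive f t lf -> is_vderive c t lc ->
  is_vderive (fun w => vscal (f w) (c w)) t (vadd (vscal lf (c t)) (vscal (f t) lc)).
Proof.
  intros H (G1 & G2 & G3); split3; apply (is_derive_Rmult f); assumption.
Qed.

Lemma is_vderive_cross c d t lc ld :
  is_vderive c t lc -> is_vderive d t ld ->
  is_vderive (fun w => cross (c w) (d w)) t (vadd (cross lc (d t)) (cross (c t) ld)).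
Proof.
  intros (H1 & H2 & H3) (G1 & G2 & G3).
  split3; unfold cross; cbn -[c1 c2 c3];
    (eapply is_derive_eq;
     [apply is_derive_Rminus; apply is_derive_Rmult; eassumption
     | unfold vadd, c1, c2, c3; simpl; ring]).
Qed.

Lemma is_derive_dot c d t lc ld :
  is_vderive c t lc -> is_vderive d t ld ->
  is_derive (fun w => dot (c w) (d w)) t (dot lc (d t) + dot (c t) ld).
Proof.
  intros (H1 & H2 & H3) (G1 & G2 & G3); unfold dot.
  eapply is_derive_eq;
    [apply is_derive_Rplus; [apply is_derive_Rplus |]; apply is_derive_Rmult; eassumption | simpl; ring].
Qed.

Lemma locally_interval a b u : in_interval a b u -> locally u (in_interval a b).
Proof.
  apply locally_open with (D := in_interval a b); [| auto].
  apply open_and; [apply open_Rbar_gt | apply open_Rbar_lt].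
Qed.

(** Used to differentiate the identities between [s] and [e], which hold on the
    open interval only. *)
Lemma is_derive_on_interval a b u (f g : R -> R) (l : R) :
  in_interval a b u -> (forall w, in_interval a b w -> f w = g w) ->
  is_derive f u l -> is_derive g u l.
Proof.
  intros Hu H; apply is_derive_ext_loc.
  eapply filter_imp; [exact H | now apply locally_interval].
Qed.

Lemma vclass_C_derive a b c u :
  vclass_C 3 (in_interval a b) c -> in_interval a b u ->
  is_vderive c u (vDerive c u) /\
  is_vderive (vDerive c) u (vDerive (vDerive c) u).
Proof.
  intros (H1 & H2 & H3) Hu.
  destruct (H1 u Hu) as [K1 _], (H2 u Hu) as [K2 _], (H3 u Hu) as [K3 _].
  split; split3; apply Derive_correct.
  - exact (K1 1%nat ltac:(lia)).
  - exact (K2 1%nat ltac:(lia)).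
  - exact (K3 1%nat ltac:(lia)).
  - exact (K1 2%nat ltac:(lia)).
  - exact (K2 2%nat ltac:(lia)).
  - exact (K3 2%nat ltac:(lia)).
Qed.

Lemma vpd1_interval a b u v (y : R -> R -> R3) c d :
  in_interval a b u -> (forall w, in_interval a b w -> y w v = c w) ->
  is_vderive c u d -> vpd i1 y u v = d.
Proof.
  intros Hu H Hd; apply is_vderive_unique.
  apply is_vderive_ext_loc with (2 := Hd).
  eapply filter_imp; [intros w Hw; symmetry; exact (H w Hw) |].
  now apply locally_interval.
Qed.

Lemma pd1_interval a b u v (f : R -> R -> R) (g : R -> R) (l : R) :
  in_interval a b u -> (forall w, in_interval a b w -> f w v = g w) ->
  is_derive g u l -> pd i1 f u v = l.
Proof.
  intros Hu H Hd; apply is_derive_unique.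
  apply (is_derive_on_interval a b u g); auto.
  intros w Hw; symmetry; auto.
Qed.

Lemma vpd2_ext u v (y : R -> R -> R3) c d :
  (forall w, y u w = c w) -> is_vderive c v d -> vpd i2 y u v = d.
Proof.
  intros H Hd; apply is_vderive_unique.
  apply is_vderive_ext_loc with (2 := Hd).
  apply filter_forall; intros w; symmetry; auto.
Qed.

Lemma pd2_ext u v (f : R -> R -> R) (g : R -> R) (l : R) :
  (forall w, f u w = g w) -> is_derive g v l -> pd i2 f u v = l.
Proof.
  intros H Hd; apply is_derive_unique.
  apply is_derive_ext with (2 := Hd); intros w; symmetry; auto.
Qed.

Lemma is_vderive_line (p q : R3) v : is_vderive (fun w => vadd p (vscal w q)) v q.
Proof.
  eapply is_vderive_eq.
  - apply is_vderive_add; [apply is_vderive_const |].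
    apply is_vderive_scal; [apply @is_derive_id | apply is_vderive_const].
  - unfold one; simpl; vec_ring.
Qed.

Lemma is_vderive_add_scal c d t lc ld v :
  is_vderive c t lc -> is_vderive d t ld ->
  is_vderive (fun w => vadd (c w) (vscal v (d w))) t (vadd lc (vscal v ld)).
Proof.
  intros Hc Hd; eapply is_vderive_eq.
  - apply is_vderive_add; [exact Hc |].
    apply (is_vderive_scal (fun _ => v)); [apply @is_derive_const | exact Hd].
  - unfold zero; simpl; vec_ring.
Qed.

(** * The moving frame of a skew ruled surface *)


Definition conical_curvature (e : R -> R3) (u : R) : R :=
  det3 (e u) (vDerive e u) (vDerive (vDerive e) u).

(** This is [delta * lambda]; since [delta <> 0] it vanishes exactly when
    [lambda] does, and it avoids the quotient. *)
Definition striction_slope (s e : R -> R3) (u : R) : R :=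
  dot (vDerive s u) (e u).


Lemma srs_derive_s a b s e (H : skew_ruled_surface a b s e) u
    (Hu : in_interval a b u) :
  is_vderive s u (vDerive s u) /\
  is_vderive (vDerive s) u (vDerive (vDerive s) u).
Proof. exact (vclass_C_derive a b s u (srs_C3_s _ _ _ _ H) Hu). Qed.

Lemma srs_derive_e a b s e (H : skew_ruled_surface a b s e) u
    (Hu : in_interval a b u) :
  is_vderive e u (vDerive e u) /\
  is_vderive (vDerive e) u (vDerive (vDerive e) u).
Proof. exact (vclass_C_derive a b e u (srs_C3_e _ _ _ _ H) Hu). Qed.

Lemma frame_relations a b s e (H : skew_ruled_surface a b s e) u
    (Hu : in_interval a b u) :
  dot (e u) (e u) = 1 /\ dot (vDerive e u) (vDerive e u) = 1 /\
  dot (e u) (vDerive e u) = 0.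
Proof.
  assert (H1 : forall w, in_interval a b w -> dot (e w) (e w) = 1)
    by (intros w Hw; apply vnorm_1_dot, (srs_unit _ _ _ _ H w Hw)).
  split; [auto | split].
  - apply vnorm_1_dot, (srs_arclength _ _ _ _ H u Hu).
  - destruct (srs_derive_e a b s e H u Hu) as [De _].
    pose proof (is_derive_dot _ _ _ _ _ De De) as D.
    apply (is_derive_on_interval a b u _ (fun _ => 1)) in D; auto.
    apply is_derive_unique in D; rewrite Derive_const in D.
    rewrite (dot_sym (vDerive e u)) in D; lra.
Qed.

(** The Frenet equation [n' = - e + kappa * z]. *)
Lemma frame_derivative a b s e (H : skew_ruled_surface a b s e) u
    (Hu : in_interval a b u) :
  vDerive (vDerive e) u =
    vadd (vscal (-1) (e u))
      (vscal (conical_curvature e u) (cross (e u) (vDerive e u))).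
Proof.
  destruct (srs_derive_e a b s e H u Hu) as [De DDe].
  destruct (frame_relations a b s e H u Hu) as (HE & HN & HEN).
  assert (A : dot (vDerive (vDerive e) u) (e u) = -1).
  { pose proof (is_derive_dot _ _ _ _ _ De DDe) as D.
    apply (is_derive_on_interval a b u _ (fun _ => 0)) in D; auto.
    - apply is_derive_unique in D; rewrite Derive_const in D.
      rewrite dot_sym; lra.
    - intros w Hw; apply (frame_relations a b s e H w Hw). }
  assert (B : dot (vDerive (vDerive e) u) (vDerive e u) = 0).
  { pose proof (is_derive_dot _ _ _ _ _ DDe DDe) as D.
    apply (is_derive_on_interval a b u _ (fun _ => 1)) in D; auto.
    - apply is_derive_unique in D; rewrite Derive_const in D.
      rewrite (dot_sym (vDerive e u)) in D; lra.
    - intros w Hw; apply (frame_relations a b s e H w Hw). }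
  rewrite (frame_decomposition (e u) (vDerive e u) (vDerive (vDerive e) u)) at 1; auto.
  rewrite A, B; unfold conical_curvature.
  set (E := e u); set (N := vDerive e u); set (V := vDerive (vDerive e) u).
  clearbody E N V. unfold det3. rewrite (dot_sym V). vec_ring.
Qed.

Lemma striction_derivative a b s e (H : skew_ruled_surface a b s e) u
    (Hu : in_interval a b u) :
  vDerive s u =
    vadd (vscal (striction_slope s e u) (e u))
      (vscal (distribution s e u) (cross (e u) (vDerive e u))).
Proof.
  destruct (frame_relations a b s e H u Hu) as (HE & HN & HEN).
  rewrite (frame_decomposition (e u) (vDerive e u) (vDerive s u)) at 1; auto.
  rewrite (srs_striction _ _ _ _ H u Hu); unfold striction_slope, distribution.
  set (E := e u); set (N := vDerive e u); set (V := vDerive s u); clearbody E N V.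
  vec_ring.
Qed.

(** The two components of [s''] that the second fundamental form needs. The first
    comes from differentiating [<s', e'> = 0]. In the derivative of [delta] the
    terms containing [e'] twice and [<s', e'>] drop out. *)
Lemma striction_second_derivative a b s e (H : skew_ruled_surface a b s e) u
    (Hu : in_interval a b u) :
  dot (vDerive (vDerive s) u) (vDerive e u) =
    striction_slope s e u - distribution s e u * conical_curvature e u /\
  is_derive (distribution s e) u
    (dot (vDerive (vDerive s) u) (cross (e u) (vDerive e u))).
Proof.
  destruct (srs_derive_e a b s e H u Hu) as [De DDe].
  destruct (srs_derive_s a b s e H u Hu) as [Ds DDs].
  destruct (frame_relations a b s e H u Hu) as (HE & HN & HEN).
  pose proof (frame_derivative a b s e H u Hu) as HE2.
  split.
  - pose proof (is_derive_dot _ _ _ _ _ DDs DDe) as D.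
    apply (is_derive_on_interval a b u _ (fun _ => 0)) in D; auto.
    2: exact (srs_striction _ _ _ _ H).
    apply is_derive_unique in D; rewrite Derive_const in D.
    rewrite HE2 in D.
    replace (dot (vDerive s u) (vadd _ _)) with
      (- striction_slope s e u + distribution s e u * conical_curvature e u) in D.
    { lra. }
    unfold striction_slope, distribution; generalize (conical_curvature e u).
    set (E := e u); set (N := vDerive e u); set (V := vDerive s u); clearbody E N V.
    vec_ring.
  - apply is_derive_ext with
      (f := fun w => dot (cross (vDerive s w) (e w)) (vDerive e w)).
    { reflexivity. }
    eapply is_derive_eq.
    { apply is_derive_dot; [apply is_vderive_cross |]; eassumption. }
    rewrite HE2.
    pose proof (srs_striction _ _ _ _ H u Hu) as HSN.
    generalize (conical_curvature e u); intros k.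
    set (E := e u) in *; set (N := vDerive e u) in *; set (V := vDerive s u) in *;
    set (V2 := vDerive (vDerive s) u); clearbody E N V V2.
    transitivity (dot V2 (cross E N) + k * (dot V E * dot E N - dot V N * dot E E));
      [vec_ring |].
    rewrite HSN, HEN; ring.
Qed.

(** * Fundamental forms and curvature *)

Definition distribution_rate (s e : R -> R3) (u : R) : R :=
  Derive (distribution s e) u.

Lemma distribution_rate_correct a b s e (H : skew_ruled_surface a b s e) u
    (Hu : in_interval a b u) :
  is_derive (distribution s e) u (distribution_rate s e u).
Proof.
  apply Derive_correct; eexists.
  apply (striction_second_derivative a b s e H u Hu).
Qed.

Lemma ruled_pd1 a b s e (H : skew_ruled_surface a b s e) u v
    (Hu : in_interval a b u) :
  vpd i1 (ruled s e) u v = vadd (vDerive s u) (vscal v (vDerive e u)).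
Proof.
  apply is_vderive_unique, is_vderive_add_scal.
  - exact (proj1 (srs_derive_s a b s e H u Hu)).
  - exact (proj1 (srs_derive_e a b s e H u Hu)).
Qed.

Lemma ruled_pd2 s e u v : vpd i2 (ruled s e) u v = e u.
Proof. apply is_vderive_unique, is_vderive_line. Qed.

Lemma ruled_pd11 a b s e (H : skew_ruled_surface a b s e) u v
    (Hu : in_interval a b u) :
  vpd i1 (vpd i1 (ruled s e)) u v =
    vadd (vDerive (vDerive s) u) (vscal v (vDerive (vDerive e) u)).
Proof.
  eapply vpd1_interval; [exact Hu | |].
  - intros w Hw; exact (ruled_pd1 a b s e H w v Hw).
  - apply is_vderive_add_scal.
    + exact (proj2 (srs_derive_s a b s e H u Hu)).
    + exact (proj2 (srs_derive_e a b s e H u Hu)).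
Qed.

Lemma ruled_pd12 a b s e (H : skew_ruled_surface a b s e) u v
    (Hu : in_interval a b u) :
  vpd i1 (vpd i2 (ruled s e)) u v = vDerive e u.
Proof.
  eapply vpd1_interval; [exact Hu | |].
  - intros w Hw; exact (ruled_pd2 s e w v).
  - exact (proj1 (srs_derive_e a b s e H u Hu)).
Qed.

Lemma ruled_pd21 a b s e (H : skew_ruled_surface a b s e) u v
    (Hu : in_interval a b u) :
  vpd i2 (vpd i1 (ruled s e)) u v = vDerive e u.
Proof.
  eapply vpd2_ext; [| apply is_vderive_line].
  intros w; exact (ruled_pd1 a b s e H u w Hu).
Qed.

Lemma ruled_pd22 s e u v : vpd i2 (vpd i2 (ruled s e)) u v = vzero.
Proof.
  eapply vpd2_ext; [| apply is_vderive_const].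
  intros w; exact (ruled_pd2 s e u w).
Qed.

Definition normal_norm2 (s e : R -> R3) (u v : R) : R :=
  v ^ 2 + distribution s e u ^ 2.

Lemma normal_norm2_pos a b s e (H : skew_ruled_surface a b s e) u v
    (Hu : in_interval a b u) :
  0 < normal_norm2 s e u v.
Proof.
  pose proof (srs_skew _ _ _ _ H u Hu) as Hd; unfold normal_norm2.
  pose proof (pow2_ge_0 v); pose proof (pow2_gt_0 _ Hd); lra.
Qed.

Lemma ruled_normal a b s e (H : skew_ruled_surface a b s e) u v
    (Hu : in_interval a b u) :
  cross (vpd i1 (ruled s e) u v) (vpd i2 (ruled s e) u v) =
    vadd (vscal (distribution s e u) (vDerive e u))
      (vscal (- v) (cross (e u) (vDerive e u))).
Proof.
  rewrite (ruled_pd1 a b s e H u v Hu), ruled_pd2.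
  rewrite (striction_derivative a b s e H u Hu).
  destruct (frame_relations a b s e H u Hu) as (HE & HN & HEN).
  generalize (striction_slope s e u) (distribution s e u); intros p d.
  set (E := e u) in *; set (N := vDerive e u) in *; clearbody E N.
  transitivity (vadd (vscal d (vadd (vscal (dot E E) N) (vscal (- dot E N) E)))
      (vscal (- v) (cross E N))); [vec_ring |].
  rewrite HE, HEN; vec_ring.
Qed.

Lemma ruled_normal_norm2 a b s e (H : skew_ruled_surface a b s e) u v
    (Hu : in_interval a b u) :
  let w := cross (vpd i1 (ruled s e) u v) (vpd i2 (ruled s e) u v) in
  dot w w = normal_norm2 s e u v.
Proof.
  intros w; unfold w; rewrite (ruled_normal a b s e H u v Hu).
  unfold normal_norm2.
  destruct (frame_relations a b s e H u Hu) as (HE & HN & HEN).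
  generalize (distribution s e u); intros d.
  set (E := e u) in *; set (N := vDerive e u) in *; clearbody E N.
  transitivity (d ^ 2 * dot N N + v ^ 2 * (dot E E * dot N N - dot E N * dot E N));
    [vec_ring |].
  rewrite HE, HN, HEN; ring.
Qed.

Lemma ruled_unit_normal a b s e (H : skew_ruled_surface a b s e) u v
    (Hu : in_interval a b u) :
  unit_normal (ruled s e) u v =
    vscal (/ sqrt (normal_norm2 s e u v))
      (vadd (vscal (distribution s e u) (vDerive e u))
        (vscal (- v) (cross (e u) (vDerive e u)))).
Proof.
  unfold unit_normal, vnorm.
  rewrite (ruled_normal_norm2 a b s e H u v Hu), (ruled_normal a b s e H u v Hu).
  reflexivity.
Qed.

(** Up to the factor [- / sqrt (normal_norm2)] this is the coefficient [h_11] of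
    the second fundamental form. *)
Definition bending (s e : R -> R3) (u v : R) : R :=
  conical_curvature e u * normal_norm2 s e u v + distribution_rate s e u * v
  - distribution s e u * striction_slope s e u.

Lemma ruled_h11 a b s e (H : skew_ruled_surface a b s e) u v
    (Hu : in_interval a b u) :
  second_form (ruled s e) u v i1 i1 =
    - bending s e u v / sqrt (normal_norm2 s e u v).
Proof.
  unfold second_form.
  rewrite (ruled_unit_normal a b s e H u v Hu), (ruled_pd11 a b s e H u v Hu).
  destruct (frame_relations a b s e H u Hu) as (HE & HN & HEN).
  destruct (striction_second_derivative a b s e H u Hu) as [H1 H2].
  apply is_derive_unique in H2; fold (distribution_rate s e u) in H2.
  rewrite (frame_derivative a b s e H u Hu).
  unfold bending, Rdiv; rewrite H2; clear H2.
  unfold normal_norm2 at 2; generalize (/ sqrt (normal_norm2 s e u v)); intros r.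
  revert H1.
  generalize (striction_slope s e u) (distribution s e u) (conical_curvature e u).
  intros p d k.
  set (E := e u) in *; set (N := vDerive e u) in *;
    set (S2 := vDerive (vDerive s) u); clearbody E N S2; intros H1.
  transitivity (r * (d * (dot S2 N - v * dot E N)
    - v * (dot S2 (cross E N) + v * k * (dot E E * dot N N - dot E N * dot E N))));
    [vec_ring |].
  rewrite H1, HE, HN, HEN; ring.
Qed.

Lemma ruled_h12 a b s e (H : skew_ruled_surface a b s e) u v
    (Hu : in_interval a b u) :
  second_form (ruled s e) u v i1 i2 =
    distribution s e u / sqrt (normal_norm2 s e u v).
Proof.
  unfold second_form.
  rewrite (ruled_unit_normal a b s e H u v Hu), (ruled_pd12 a b s e H u v Hu).
  destruct (frame_relations a b s e H u Hu) as (_ & HN & _).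
  unfold Rdiv; generalize (/ sqrt (normal_norm2 s e u v)) (distribution s e u).
  intros r d; set (E := e u) in *; set (N := vDerive e u) in *; clearbody E N.
  transitivity (r * d * dot N N); [vec_ring | rewrite HN; ring].
Qed.

Lemma ruled_h21 a b s e (H : skew_ruled_surface a b s e) u v
    (Hu : in_interval a b u) :
  second_form (ruled s e) u v i2 i1 =
    distribution s e u / sqrt (normal_norm2 s e u v).
Proof.
  rewrite <- (ruled_h12 a b s e H u v Hu); unfold second_form.
  now rewrite (ruled_pd12 a b s e H u v Hu), (ruled_pd21 a b s e H u v Hu).
Qed.

Lemma ruled_h22 s e u v : second_form (ruled s e) u v i2 i2 = 0.
Proof.
  unfold second_form; rewrite ruled_pd22.
  generalize (unit_normal (ruled s e) u v); vec_ring.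
Qed.

Lemma ruled_gauss_curvature a b s e (H : skew_ruled_surface a b s e) u v
    (Hu : in_interval a b u) :
  gauss_curvature (ruled s e) u v =
    - (distribution s e u ^ 2 / normal_norm2 s e u v ^ 2).
Proof.
  unfold gauss_curvature.
  assert (Hg : det2 (first_form (ruled s e) u v) = normal_norm2 s e u v).
  { rewrite <- (ruled_normal_norm2 a b s e H u v Hu).
    unfold det2, first_form.
    generalize (vpd i1 (ruled s e) u v) (vpd i2 (ruled s e) u v); vec_ring. }
  rewrite Hg; unfold det2.
  rewrite (ruled_h11 a b s e H u v Hu), (ruled_h12 a b s e H u v Hu),
    (ruled_h21 a b s e H u v Hu), ruled_h22.
  pose proof (normal_norm2_pos a b s e H u v Hu) as HW.
  pose proof (sqrt_lt_R0 _ HW) as Hs.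
  transitivity (- (distribution s e u ^ 2 /
    (sqrt (normal_norm2 s e u v) * sqrt (normal_norm2 s e u v)) /
    normal_norm2 s e u v)).
  - field; lra.
  - rewrite sqrt_sqrt by lra; field; lra.
Qed.

(** * Relative metric and Darboux tensor *)

(** The common factor of the coefficients of the relative metric: [1 / q] times
    the inverse norm of the cross product of [x_u] and [x_v]. In exponential form
    its partial derivatives are rational multiples of itself. *)
Definition metric_factor (s e : R -> R3) (alpha u v : R) : R :=
  exp (- alpha * ln (distribution s e u ^ 2 / normal_norm2 s e u v ^ 2)
       - 1 / 2 * ln (normal_norm2 s e u v)).

Lemma inv_support_metric_factor a b s e (H : skew_ruled_surface a b s e)
    alpha u v (Hu : in_interval a b u) :
  / support (ruled s e) (manhart_normalization (ruled s e) alpha) u v *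
    / sqrt (normal_norm2 s e u v) = metric_factor s e alpha u v.
Proof.
  unfold manhart_normalization.
  rewrite support_normalization by exact (srs_immersion _ _ _ _ H u v Hu).
  unfold manhart_support, metric_factor.
  rewrite (ruled_gauss_curvature a b s e H u v Hu).
  pose proof (normal_norm2_pos a b s e H u v Hu) as HW.
  set (W := normal_norm2 s e u v) in *.
  rewrite Rabs_Ropp, Rabs_pos_eq.
  2: { apply Rmult_le_pos; [apply pow2_ge_0 |].
       apply Rlt_le, Rinv_0_lt_compat, pow_lt, HW. }
  rewrite <- (Rpower_sqrt W HW); unfold Rpower, Rminus.
  rewrite exp_plus, Ropp_mult_distr_l_reverse, !exp_Ropp.
  replace (1 / 2) with (/ 2) by field.
  reflexivity.
Qed.

Lemma relative_metric_second_form a b s e (H : skew_ruled_surface a b s e)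
    alpha u v (Hu : in_interval a b u) i j r :
  second_form (ruled s e) u v i j = r / sqrt (normal_norm2 s e u v) ->
  relative_metric (ruled s e) (manhart_normalization (ruled s e) alpha) u v i j =
    metric_factor s e alpha u v * r.
Proof.
  intros Hr; unfold relative_metric.
  rewrite Hr, <- (inv_support_metric_factor a b s e H alpha u v Hu).
  unfold Rdiv; ring.
Qed.

Lemma relative_metric_11 a b s e (H : skew_ruled_surface a b s e) alpha u v
    (Hu : in_interval a b u) :
  relative_metric (ruled s e) (manhart_normalization (ruled s e) alpha) u v i1 i1 =
    metric_factor s e alpha u v * - bending s e u v.
Proof. eapply relative_metric_second_form; eauto using ruled_h11. Qed.

Lemma relative_metric_12 a b s e (H : skew_ruled_surface a b s e) alpha u v
    (Hu : in_interval a b u) :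
  relative_metric (ruled s e) (manhart_normalization (ruled s e) alpha) u v i1 i2 =
    metric_factor s e alpha u v * distribution s e u.
Proof. eapply relative_metric_second_form; eauto using ruled_h12. Qed.

Lemma relative_metric_21 a b s e (H : skew_ruled_surface a b s e) alpha u v
    (Hu : in_interval a b u) :
  relative_metric (ruled s e) (manhart_normalization (ruled s e) alpha) u v i2 i1 =
    metric_factor s e alpha u v * distribution s e u.
Proof. eapply relative_metric_second_form; eauto using ruled_h21. Qed.

Lemma relative_metric_22 s e y u v :
  relative_metric (ruled s e) y u v i2 i2 = 0.
Proof. unfold relative_metric; rewrite ruled_h22; ring. Qed.

Lemma metric_factor_pos s e alpha u v : 0 < metric_factor s e alpha u v.
Proof. apply exp_pos. Qed.

Lemma is_derive_exp_comp (f : R -> R) t l :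
  is_derive f t l -> is_derive (fun w => exp (f w)) t (exp (f t) * l).
Proof.
  intros D; eapply is_derive_eq.
  - apply (is_derive_comp exp); [apply is_derive_exp | exact D].
  - apply Rmult_comm.
Qed.

Lemma metric_factor_d1 a b s e (H : skew_ruled_surface a b s e) alpha u v
    (Hu : in_interval a b u) :
  is_derive (fun w => metric_factor s e alpha w v) u
    (metric_factor s e alpha u v * (distribution_rate s e u *
      ((4 * alpha - 1) * distribution s e u / normal_norm2 s e u v
       - 2 * alpha / distribution s e u))).
Proof.
  pose proof (distribution_rate_correct a b s e H u Hu) as D.
  pose proof (srs_skew _ _ _ _ H u Hu) as Hd.
  pose proof (normal_norm2_pos a b s e H u v Hu) as HW.
  unfold metric_factor, normal_norm2, distribution_rate in *.
  set (d := distribution s e) in *; clearbody d.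
  assert (Hdd : 0 < d u ^ 2) by now apply pow2_gt_0.
  assert (HW2 : 0 < (v ^ 2 + d u ^ 2) ^ 2) by now apply pow_lt.
  apply (is_derive_exp_comp (fun w =>
    - alpha * ln (d w ^ 2 / (v ^ 2 + d w ^ 2) ^ 2)
    - 1 / 2 * ln (v ^ 2 + d w ^ 2))).
  auto_derive.
  - repeat split; try (exists (Derive d u); exact D); try lra.
    apply Rmult_lt_0_compat; [simpl in Hdd; lra |].
    apply Rinv_0_lt_compat; simpl in HW2; lra.
  - change (Derive (fun x : R => d x) u) with (Derive d u).
    field.
    simpl in *; lra.
Qed.

Lemma metric_factor_d2 a b s e (H : skew_ruled_surface a b s e) alpha u v
    (Hu : in_interval a b u) :
  is_derive (fun w => metric_factor s e alpha u w) v
    (metric_factor s e alpha u v * ((4 * alpha - 1) * v / normal_norm2 s e u v)).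
Proof.
  pose proof (srs_skew _ _ _ _ H u Hu) as Hd.
  pose proof (normal_norm2_pos a b s e H u v Hu) as HW.
  unfold metric_factor, normal_norm2 in *.
  set (d := distribution s e u) in *; clearbody d.
  assert (Hdd : 0 < d ^ 2) by now apply pow2_gt_0.
  assert (HW2 : 0 < (v ^ 2 + d ^ 2) ^ 2) by now apply pow_lt.
  apply (is_derive_exp_comp (fun w =>
    - alpha * ln (d ^ 2 / (w ^ 2 + d ^ 2) ^ 2)
    - 1 / 2 * ln (w ^ 2 + d ^ 2))).
  auto_derive.
  - repeat split; try lra.
    apply Rmult_lt_0_compat; [simpl in Hdd; lra |].
    apply Rinv_0_lt_compat; simpl in HW2; lra.
  - field; simpl in *; lra.
Qed.

Lemma metric_pd2_12 a b s e (H : skew_ruled_surface a b s e) alpha u v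
    (Hu : in_interval a b u) i j : i <> j ->
  pd i2 (fun s' t' => relative_metric (ruled s e)
    (manhart_normalization (ruled s e) alpha) s' t' i j) u v =
    metric_factor s e alpha u v * ((4 * alpha - 1) * v / normal_norm2 s e u v)
      * distribution s e u.
Proof.
  intros Hij; eapply pd2_ext with
    (g := fun w => metric_factor s e alpha u w * distribution s e u).
  - intros w; destruct i, j; try congruence;
      [apply (relative_metric_12 a b s e H alpha u w Hu)
      | apply (relative_metric_21 a b s e H alpha u w Hu)].
  - eapply is_derive_eq.
    + apply is_derive_Rmult;
        [apply (metric_factor_d2 a b s e H alpha u v Hu) | apply @is_derive_const].
    + unfold zero; simpl; ring.
Qed.

Lemma metric_pd1_12 a b s e (H : skew_ruled_surface a b s e) alpha u v
    (Hu : in_interval a b u) i j : i <> j ->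
  pd i1 (fun s' t' => relative_metric (ruled s e)
    (manhart_normalization (ruled s e) alpha) s' t' i j) u v =
    metric_factor s e alpha u v * distribution_rate s e u *
      (1 - 2 * alpha +
       (4 * alpha - 1) * distribution s e u ^ 2 / normal_norm2 s e u v).
Proof.
  intros Hij; eapply pd1_interval with
    (g := fun w => metric_factor s e alpha w v * distribution s e w);
    [exact Hu | |].
  - intros w Hw; destruct i, j; try congruence;
      [apply (relative_metric_12 a b s e H alpha w v Hw)
      | apply (relative_metric_21 a b s e H alpha w v Hw)].
  - eapply is_derive_eq.
    + apply is_derive_Rmult;
        [apply (metric_factor_d1 a b s e H alpha u v Hu)
        | apply (distribution_rate_correct a b s e H u Hu)].
    + pose proof (normal_norm2_pos a b s e H u v Hu).
      pose proof (srs_skew _ _ _ _ H u Hu). cbv beta; field; lra.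
Qed.

Lemma metric_pd2_11 a b s e (H : skew_ruled_surface a b s e) alpha u v
    (Hu : in_interval a b u) :
  pd i2 (fun s' t' => relative_metric (ruled s e)
    (manhart_normalization (ruled s e) alpha) s' t' i1 i1) u v =
    - metric_factor s e alpha u v *
      ((4 * alpha - 1) * v / normal_norm2 s e u v * bending s e u v
       + 2 * conical_curvature e u * v + distribution_rate s e u).
Proof.
  eapply pd2_ext with
    (g := fun w => metric_factor s e alpha u w * - bending s e u w).
  - intros w; apply (relative_metric_11 a b s e H alpha u w Hu).
  - assert (D : is_derive (fun w => - bending s e u w) v
      (- (2 * conical_curvature e u * v + distribution_rate s e u))).
    { unfold bending, normal_norm2; auto_derive; [exact I | ring]. }
    eapply is_derive_eq.
    + apply is_derive_Rmult;
        [apply (metric_factor_d2 a b s e H alpha u v Hu) | exact D].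
    + cbv beta; ring.
Qed.

Lemma metric_pd_22 s e y i u v :
  pd i (fun s' t' => relative_metric (ruled s e) y s' t' i2 i2) u v = 0.
Proof.
  destruct i.
  - apply is_derive_unique; apply is_derive_ext with (f := fun _ => 0);
      [intros; symmetry; apply relative_metric_22 | apply @is_derive_const].
  - apply pd2_ext with (g := fun _ => 0);
      [intros; apply relative_metric_22 | apply @is_derive_const].
Qed.

Lemma darboux_222 s e y u v : darboux (ruled s e) y u v i2 i2 i2 = 0.
Proof.
  unfold darboux; rewrite metric_pd_22.
  rewrite (vpd2_ext u v (vpd i2 (vpd i2 (ruled s e))) (fun _ => vzero) vzero);
    [| intros; apply ruled_pd22 | apply is_vderive_const].
  generalize (unit_normal (ruled s e) u v); vec_ring.
Qed.

(** The value of [A_122], which is minus the [v]-derivative of [G_12]. *)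
Definition darboux_value_122 (s e : R -> R3) (alpha u v : R) : R :=
  - metric_factor s e alpha u v * ((4 * alpha - 1) * v / normal_norm2 s e u v)
    * distribution s e u.

(** The three arrangements of the indices differ in the order of partial
    differentiation of [x], so their equality is part of the claim. *)
Lemma darboux_122 a b s e (H : skew_ruled_surface a b s e) alpha u v
    (Hu : in_interval a b u) :
  let A := darboux (ruled s e) (manhart_normalization (ruled s e) alpha) u v in
  A i1 i2 i2 = darboux_value_122 s e alpha u v /\
  A i2 i1 i2 = darboux_value_122 s e alpha u v /\
  A i2 i2 i1 = darboux_value_122 s e alpha u v.
Proof.
  assert (E1 : vpd i1 (vpd i2 (vpd i2 (ruled s e))) u v = vzero).
  { eapply vpd1_interval; [exact Hu | | apply is_vderive_const].
    intros; apply ruled_pd22. }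
  assert (E2 : vpd i2 (vpd i1 (vpd i2 (ruled s e))) u v = vzero).
  { eapply vpd2_ext; [| apply is_vderive_const].
    intros w; apply (ruled_pd12 a b s e H u w Hu). }
  assert (E3 : vpd i2 (vpd i2 (vpd i1 (ruled s e))) u v = vzero).
  { eapply vpd2_ext; [| apply is_vderive_const].
    intros w; apply (ruled_pd21 a b s e H u w Hu). }
  intros A; unfold A, darboux.
  rewrite E1, E2, E3, metric_pd_22.
  rewrite !(metric_pd2_12 a b s e H) by (congruence || exact Hu).
  unfold darboux_value_122.
  replace (dot (unit_normal (ruled s e) u v) vzero) with 0
    by (generalize (unit_normal (ruled s e) u v); vec_ring).
  rewrite Rmult_0_r; split3; field; apply Rgt_not_eq, (normal_norm2_pos a b s e H u v Hu).
Qed.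

Definition darboux_value_112 (s e : R -> R3) (alpha u v : R) : R :=
  metric_factor s e alpha u v * (4 * alpha - 1) / (2 * normal_norm2 s e u v) *
    (v * bending s e u v
     + distribution_rate s e u * (v ^ 2 - distribution s e u ^ 2)).

(** The terms of the [v]-derivative of [G_11] that come from [bending] cancel
    [<xi, x_uuv>] and half of the [u]-derivative of [delta]; all that is left has
    the factor [4 * alpha - 1], twice the exponent of [normal_norm2] in the metric
    factor. *)
Lemma darboux_112 a b s e (H : skew_ruled_surface a b s e) alpha u v
    (Hu : in_interval a b u) :
  let A := darboux (ruled s e) (manhart_normalization (ruled s e) alpha) u v in
  A i1 i1 i2 = darboux_value_112 s e alpha u v /\
  A i1 i2 i1 = darboux_value_112 s e alpha u v /\
  A i2 i1 i1 = darboux_value_112 s e alpha u v.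
Proof.
  destruct (srs_derive_e a b s e H u Hu) as [_ DDe].
  assert (E1 : vpd i1 (vpd i1 (vpd i2 (ruled s e))) u v = vDerive (vDerive e) u).
  { eapply vpd1_interval; [exact Hu | | exact DDe].
    intros w Hw; apply (ruled_pd12 a b s e H w v Hw). }
  assert (E2 : vpd i1 (vpd i2 (vpd i1 (ruled s e))) u v = vDerive (vDerive e) u).
  { eapply vpd1_interval; [exact Hu | | exact DDe].
    intros w Hw; apply (ruled_pd21 a b s e H w v Hw). }
  assert (E3 : vpd i2 (vpd i1 (vpd i1 (ruled s e))) u v = vDerive (vDerive e) u).
  { eapply vpd2_ext; [| apply is_vderive_line].
    intros w; apply (ruled_pd11 a b s e H u w Hu). }
  assert (Hn : / support (ruled s e) (manhart_normalization (ruled s e) alpha) u v *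
      dot (unit_normal (ruled s e) u v) (vDerive (vDerive e) u) =
      - metric_factor s e alpha u v * v * conical_curvature e u).
  { rewrite <- (inv_support_metric_factor a b s e H alpha u v Hu).
    rewrite (ruled_unit_normal a b s e H u v Hu), (frame_derivative a b s e H u Hu).
    destruct (frame_relations a b s e H u Hu) as (HE & HN & HEN).
    generalize (/ support (ruled s e) (manhart_normalization (ruled s e) alpha) u v)
      (/ sqrt (normal_norm2 s e u v)) (distribution s e u) (conical_curvature e u).
    intros q r d k.
    set (E := e u) in *; set (N := vDerive e u) in *; clearbody E N.
    transitivity (q * r * (- d * dot E N
      - v * k * (dot E E * dot N N - dot E N * dot E N))); [vec_ring |].
    rewrite HE, HN, HEN; ring. }
  intros A; unfold A, darboux.
  rewrite E1, E2, E3, Hn, (metric_pd2_11 a b s e H alpha u v Hu).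
  rewrite !(metric_pd1_12 a b s e H) by (congruence || exact Hu).
  pose proof (normal_norm2_pos a b s e H u v Hu) as HW.
  (* The only place where [v], [delta] and [normal_norm2] have to be related. *)
  assert (Hv : v ^ 2 = normal_norm2 s e u v - distribution s e u ^ 2)
    by (unfold normal_norm2; ring).
  unfold darboux_value_112; rewrite Hv.
  split3; field; lra.
Qed.

(** * Tchebychev vector and Pick invariant *)

(** If [G_22 = 0] then [G^11 = 0], so every index [1] of a contraction is paired
    with an index [2]. With [A_222 = 0] this leaves only [A_122] and [A_112]. *)
Lemma null_coordinate_invariants (x y : R -> R -> R3) (u v g11 g12 a12 a11 : R) :
  g12 <> 0 ->
  relative_metric x y u v i1 i1 = g11 ->
  relative_metric x y u v i1 i2 = g12 ->
  relative_metric x y u v i2 i1 = g12 ->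
  relative_metric x y u v i2 i2 = 0 ->
  darboux x y u v i2 i2 i2 = 0 ->
  (darboux x y u v i1 i2 i2 = a12 /\ darboux x y u v i2 i1 i2 = a12 /\
   darboux x y u v i2 i2 i1 = a12) ->
  (darboux x y u v i1 i1 i2 = a11 /\ darboux x y u v i1 i2 i1 = a11 /\
   darboux x y u v i2 i1 i1 = a11) ->
  tchebychev_up x y u v i1 = a12 / g12 ^ 2 /\
  tchebychev_up x y u v i2 = (a11 - 3 / 2 * a12 * g11 / g12) / g12 ^ 2 /\
  pick x y u v = 3 * a12 * (a11 - a12 * g11 / g12) / g12 ^ 3.
Proof.
  intros Hg G11 G12 G21 G22 A0 (A1 & A2 & A3) (B1 & B2 & B3).
  unfold pick, tchebychev_up, tchebychev_low, darboux_up, relative_metric_inv,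
    inv2, det2, sum2.
  rewrite G11, G12, G21, G22, A0, A1, A2, A3, B1, B2, B3.
  split3; field; nra.
Qed.

(** In expanded form
    [- (k * v^3 + (k * delta^2 - delta^2 * lambda) * v + delta' * delta^2)], the
    part of the Pick invariant that depends on the invariants [k], [lambda] and
    [delta'] of the surface; here [k] is the conical curvature. *)
Definition pick_factor (s e : R -> R3) (u v : R) : R :=
  distribution_rate s e u * (v ^ 2 - distribution s e u ^ 2)
  - v * bending s e u v.

Lemma ruled_invariants a b s e (H : skew_ruled_surface a b s e) alpha u v
    (Hu : in_interval a b u) :
  let y := manhart_normalization (ruled s e) alpha in
  let d := distribution s e u in
  let W := normal_norm2 s e u v in
  let f := metric_factor s e alpha u v in
  tchebychev_up (ruled s e) y u v i1 = - (4 * alpha - 1) * v / (f * d * W) /\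
  tchebychev_up (ruled s e) y u v i2 =
    (4 * alpha - 1) * (pick_factor s e u v - v * bending s e u v)
      / (2 * f * d ^ 2 * W) /\
  pick (ruled s e) y u v =
    - 3 * (4 * alpha - 1) ^ 2 * v * pick_factor s e u v / (2 * f * d ^ 2 * W ^ 2).
Proof.
  intros y d W f.
  pose proof (srs_skew _ _ _ _ H u Hu) as Hd.
  pose proof (normal_norm2_pos a b s e H u v Hu) as HW.
  pose proof (metric_factor_pos s e alpha u v) as Hf.
  destruct (null_coordinate_invariants (ruled s e) y u v _ _ _ _
    (Rmult_integral_contrapositive_currified _ _ (Rgt_not_eq _ _ Hf) Hd)
    (relative_metric_11 a b s e H alpha u v Hu)
    (relative_metric_12 a b s e H alpha u v Hu)
    (relative_metric_21 a b s e H alpha u v Hu)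
    (relative_metric_22 s e y u v) (darboux_222 s e y u v)
    (darboux_122 a b s e H alpha u v Hu) (darboux_112 a b s e H alpha u v Hu))
    as (-> & -> & ->).
  unfold darboux_value_122, darboux_value_112, pick_factor.
  fold d W f in Hd, HW, Hf |- *.
  split3; field; repeat split; lra.
Qed.

(** * Vanishing of the invariants *)

Definition helicoidal_at (s e : R -> R3) (u : R) : Prop :=
  conical_curvature e u = 0 /\ striction_slope s e u = 0 /\
  distribution_rate s e u = 0.

Lemma cubic_zero (c3 c2 c1 c0 : R) :
  (forall v, v <> 0 -> c3 * v ^ 3 + c2 * v ^ 2 + c1 * v + c0 = 0) ->
  c3 = 0 /\ c2 = 0 /\ c1 = 0 /\ c0 = 0.
Proof.
  intros H.
  pose proof (H 1 ltac:(lra)); pose proof (H (-1) ltac:(lra)).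
  pose proof (H 2 ltac:(lra)); pose proof (H (-2) ltac:(lra)).
  repeat split; lra.
Qed.

(** With [k], [p], [r], [d] for the conical curvature, the slope
    [delta * lambda], [delta'] and [delta], the coefficients of this cubic in [v]
    are [- c * k], [(1 - c) * r], [- c * (k * d^2 - d * p)] and [- r * d^2]. *)
Lemma helicoidal_of_vanishing a b s e (H : skew_ruled_surface a b s e) u
    (Hu : in_interval a b u) (c : R) : 0 < c ->
  (forall v, v <> 0 ->
     pick_factor s e u v - (c - 1) * (v * bending s e u v) = 0) ->
  helicoidal_at s e u.
Proof.
  intros Hc Hv; pose proof (srs_skew _ _ _ _ H u Hu) as Hd.
  unfold helicoidal_at; revert Hv; unfold pick_factor, bending, normal_norm2.
  set (d := distribution s e u) in *; set (k := conical_curvature e u);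
  set (p := striction_slope s e u); set (r := distribution_rate s e u); intros Hv.
  destruct (cubic_zero (- c * k) ((1 - c) * r) (- c * (k * d ^ 2 - d * p))
    (- r * d ^ 2)) as (H3 & _ & H1 & H0).
  { intros v Hv0; rewrite <- (Hv v Hv0); ring. }
  assert (Hk : k = 0) by nra.
  rewrite Hk in *.
  assert (Hdp : d * p = 0) by nra.
  assert (Hrd : r * d ^ 2 = 0) by lra.
  apply Rmult_integral in Hdp; apply Rmult_integral in Hrd.
  pose proof (pow_nonzero d 2 Hd); tauto.
Qed.

Lemma helicoidal_bending s e u v :
  helicoidal_at s e u -> bending s e u v = 0 /\ pick_factor s e u v = 0.
Proof.
  intros (Hk & Hp & Hr); unfold pick_factor, bending; rewrite Hk, Hp, Hr.
  split; ring.
Qed.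

Lemma push_injective (x : R -> R -> R3) u v (w w' : idx -> R) (k : R) :
  cross (vpd i1 x u v) (vpd i2 x u v) <> vzero ->
  push x u v w = vscal k (push x u v w') ->
  w i1 = k * w' i1 /\ w i2 = k * w' i2.
Proof.
  unfold push; generalize (vpd i1 x u v) (vpd i2 x u v) (w i1) (w i2) (w' i1) (w' i2).
  clear; intros P Q t1 t2 t1' t2' Hw Ht.
  assert (A : vscal (t1 - k * t1') (cross P Q) = vzero).
  { transitivity (cross (vadd (vadd (vscal t1 P) (vscal t2 Q))
      (vscal (-1) (vscal k (vadd (vscal t1' P) (vscal t2' Q))))) Q);
      [vec_ring | rewrite Ht; vec_ring]. }
  assert (B : vscal (t2 - k * t2') (cross P Q) = vzero).
  { transitivity (cross P (vadd (vadd (vscal t1 P) (vscal t2 Q))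
      (vscal (-1) (vscal k (vadd (vscal t1' P) (vscal t2' Q))))));
      [vec_ring | rewrite Ht; vec_ring]. }
  assert (Z : forall r, vscal r (cross P Q) = vzero -> r = 0).
  { intros r Hr; destruct (Req_dec r 0) as [| Hr0]; [assumption |].
    exfalso; apply Hw; transitivity (vscal (/ r) (vscal r (cross P Q))).
    - generalize (cross P Q); intros [[X Y] Z'].
      unfold vscal, c1, c2, c3; cbn [fst snd]; f_equal; [f_equal |]; field; assumption.
    - rewrite Hr; vec_ring. }
  apply Z in A; apply Z in B; split; lra.
Qed.

Lemma gauss_curvature_pd a b s e (H : skew_ruled_surface a b s e) u v
    (Hu : in_interval a b u) :
  pd i1 (gauss_curvature (ruled s e)) u v =
    2 * distribution s e u * distribution_rate s e u *
      (distribution s e u ^ 2 - v ^ 2) / normal_norm2 s e u v ^ 3 /\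
  pd i2 (gauss_curvature (ruled s e)) u v =
    4 * distribution s e u ^ 2 * v / normal_norm2 s e u v ^ 3.
Proof.
  pose proof (normal_norm2_pos a b s e H u v Hu) as HW.
  assert (HW2 : 0 < normal_norm2 s e u v ^ 2) by now apply pow_lt.
  pose proof (distribution_rate_correct a b s e H u Hu) as D.
  unfold distribution_rate in *.
  split.
  - eapply pd1_interval; [exact Hu | |].
    + intros w Hw; apply (ruled_gauss_curvature a b s e H w v Hw).
    + unfold normal_norm2 in *; set (d := distribution s e) in *; clearbody d.
      auto_derive.
      * repeat split; try (exists (Derive d u); exact D); simpl in *; lra.
      * change (Derive (fun x : R => d x) u) with (Derive d u); field; simpl in *; lra.
  - eapply pd2_ext; [intros w; apply (ruled_gauss_curvature a b s e H u w Hu) |].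
    unfold normal_norm2 in *; set (d := distribution s e u) in *; clearbody d.
    auto_derive.
    * simpl in *; lra.
    * field; simpl in *; lra.
Qed.

Lemma quotient_zero x y : y <> 0 -> x / y = 0 -> x = 0.
Proof.
  intros Hy Hx; transitivity (x / y * y); [field; exact Hy | rewrite Hx; ring].
Qed.

(** At [v <> 0] each tangency condition becomes
    [pick_factor - (c - 1) * v * bending = 0] after division by
    [4 * alpha - 1] and nonzero factors, with [c = 1] for asymptotic lines and
    curves of constant curvature and [c = 2] for curves of constant striction
    distance. *)
Lemma helicoidal_of_tangent a b s e alpha (H : skew_ruled_surface a b s e)
    (Halpha : alpha <> 1 / 4) :
  let x := ruled s e in
  let y := manhart_normalization x alpha in
  tangent_curved_asymptotic_lines a b x (tchebychev x y) \/
  tangent_striction_distance_curves a b x (tchebychev x y) \/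
  tangent_K_curves a b x (tchebychev_up x y) ->
  forall u, in_interval a b u -> helicoidal_at s e u.
Proof.
  cbv zeta; intros Hi u Hu.
  assert (Hm : 4 * alpha - 1 <> 0) by lra.
  pose proof (srs_skew _ _ _ _ H u Hu) as Hd.
  destruct Hi as [Hi | [Hi | Hi]].
  - apply (helicoidal_of_vanishing a b s e H u Hu 1); [lra |]; intros v Hv.
    destruct (Hi u v Hu) as (r & cu & cv & Hr & Hc & <- & <- & k & Hk).
    destruct (Hc 0 ltac:(rewrite Rabs_R0; exact Hr))
      as (_ & _ & _ & _ & _ & Hasy & Hreg).
    clear Hi Hc; set (u := cu 0) in *; set (v := cv 0) in *.
    apply push_injective in Hk; [| exact (srs_immersion _ _ _ _ H u v Hu)].
    cbn beta iota in Hk.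
    revert Hasy; unfold sum2.
    rewrite (ruled_h11 a b s e H u v Hu), (ruled_h12 a b s e H u v Hu),
      (ruled_h21 a b s e H u v Hu), ruled_h22.
    destruct (ruled_invariants a b s e H alpha u v Hu) as (T1 & T2 & _).
    rewrite T1, T2 in Hk; destruct Hk as [K1 K2]; clear T1 T2.
    pose proof (normal_norm2_pos a b s e H u v Hu) as HW.
    pose proof (sqrt_lt_R0 _ HW) as Hs.
    pose proof (metric_factor_pos s e alpha u v) as Hf.
    set (d := distribution s e u) in *; set (W := normal_norm2 s e u v) in *;
    set (f := metric_factor s e alpha u v) in *; set (N := bending s e u v) in *;
    set (Q := pick_factor s e u v) in *; set (m := 4 * alpha - 1) in *.
    set (t1 := Derive cu 0) in *; set (t2 := Derive cv 0) in *.
    intros Hasy.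
    (* The asymptotic direction other than the ruling, where [t1 <> 0]. *)
    assert (A : t1 * (2 * d * t2 - N * t1) = 0).
    { apply (quotient_zero _ (sqrt W)); [lra |]; rewrite <- Hasy; field; lra. }
    apply Rmult_integral in A; destruct A as [A | A]; [contradiction |].
    assert (B : m * Q = 0).
    { apply (quotient_zero _ (f * d * W)).
      - repeat apply Rmult_integral_contrapositive_currified; lra.
      - transitivity (2 * d * (m * (Q - v * N) / (2 * f * d ^ 2 * W))
          - N * (- m * v / (f * d * W))).
        + field; repeat split; lra.
        + rewrite K1, K2; transitivity (k * (2 * d * t2 - N * t1)); [ring |].
          rewrite A; ring. }
    apply Rmult_integral in B; destruct B as [B | B]; [contradiction | lra].
  - apply (helicoidal_of_vanishing a b s e H u Hu 2); [lra |]; intros v Hv.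
    destruct (Hi u v Hu) as (k & Hk).
    assert (Hk' : tchebychev (ruled s e) (manhart_normalization (ruled s e) alpha) u v
      = vscal k (push (ruled s e) u v (fun i => match i with i1 => 1 | i2 => 0 end))).
    { rewrite Hk; unfold push; f_equal.
      generalize (vpd i1 (ruled s e) u v) (vpd i2 (ruled s e) u v); vec_ring. }
    apply push_injective in Hk'; [| exact (srs_immersion _ _ _ _ H u v Hu)].
    destruct Hk' as [_ Hk']; cbn beta iota in Hk'.
    destruct (ruled_invariants a b s e H alpha u v Hu) as (_ & T2 & _).
    rewrite T2, Rmult_0_r in Hk'.
    pose proof (normal_norm2_pos a b s e H u v Hu) as HW.
    pose proof (metric_factor_pos s e alpha u v) as Hf.
    apply quotient_zero in Hk'.
    + apply Rmult_integral in Hk'; destruct Hk'; [contradiction | lra].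
    + pose proof (pow_nonzero _ 2 Hd).
      repeat apply Rmult_integral_contrapositive_currified; lra.
  - apply (helicoidal_of_vanishing a b s e H u Hu 1); [lra |]; intros v Hv.
    pose proof (Hi u v Hu) as Hk; revert Hk; unfold sum2.
    destruct (gauss_curvature_pd a b s e H u v Hu) as [-> ->].
    destruct (ruled_invariants a b s e H alpha u v Hu) as (-> & -> & _).
    pose proof (normal_norm2_pos a b s e H u v Hu) as HW.
    pose proof (metric_factor_pos s e alpha u v) as Hf.
    pose proof (pow_lt _ 4 HW) as HW4.
    unfold pick_factor.
    set (d := distribution s e u) in *; set (W := normal_norm2 s e u v) in *;
    set (f := metric_factor s e alpha u v) in *; set (N := bending s e u v) in *;
    set (r := distribution_rate s e u) in *; set (m := 4 * alpha - 1) in *.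
    intros Hk.
    assert (B : m * (4 * v) * (r * (v ^ 2 - d ^ 2) - v * N) = 0).
    { apply (quotient_zero _ (f * W ^ 4)).
      - repeat apply Rmult_integral_contrapositive_currified; lra.
      - rewrite <- Hk; field; repeat split; lra. }
    apply Rmult_integral in B; destruct B as [B | B]; [| lra].
    apply Rmult_integral in B; lra.
Qed.

(** If the invariants vanish, so does [T^2]. *)
Lemma tangent_of_helicoidal a b s e alpha (H : skew_ruled_surface a b s e) :
  let x := ruled s e in
  (forall u, in_interval a b u -> helicoidal_at s e u) ->
  tangent_striction_distance_curves a b x
    (tchebychev x (manhart_normalization x alpha)).
Proof.
  cbv zeta; intros Hh u v Hu.
  destruct (helicoidal_bending s e u v (Hh u Hu)) as [HN HQ].
  exists (tchebychev_up (ruled s e) (manhart_normalization (ruled s e) alpha) u v i1).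
  unfold tchebychev, push.
  destruct (ruled_invariants a b s e H alpha u v Hu) as (_ & -> & _).
  rewrite HN, HQ.
  generalize (tchebychev_up (ruled s e) (manhart_normalization (ruled s e) alpha) u v i1)
    (vpd i1 (ruled s e) u v) (vpd i2 (ruled s e) u v).
  unfold Rdiv; vec_ring.
Qed.

Lemma pick_zero_iff_helicoidal a b s e alpha (H : skew_ruled_surface a b s e)
    (Halpha : alpha <> 1 / 4) :
  let x := ruled s e in
  (forall u v, in_interval a b u -> pick x (manhart_normalization x alpha) u v = 0)
  <-> (forall u, in_interval a b u -> helicoidal_at s e u).
Proof.
  cbv zeta; split; intros Hp u.
  - intros Hu; apply (helicoidal_of_vanishing a b s e H u Hu 1); [lra |].
    intros v Hv.
    destruct (ruled_invariants a b s e H alpha u v Hu) as (_ & _ & J).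
    rewrite (Hp u v Hu) in J; symmetry in J.
    pose proof (srs_skew _ _ _ _ H u Hu) as Hd.
    pose proof (normal_norm2_pos a b s e H u v Hu) as HW.
    pose proof (metric_factor_pos s e alpha u v) as Hf.
    apply quotient_zero in J.
    + assert (Hm : (4 * alpha - 1) ^ 2 <> 0) by (apply pow_nonzero; lra).
      repeat (apply Rmult_integral in J; destruct J as [J | J]; try lra).
    + pose proof (pow_nonzero _ 2 Hd); pose proof (pow_lt _ 2 HW).
      repeat apply Rmult_integral_contrapositive_currified; lra.
  - intros v Hu.
    destruct (ruled_invariants a b s e H alpha u v Hu) as (_ & _ & ->).
    destruct (helicoidal_bending s e u v (Hp u Hu)) as [_ ->].
    unfold Rdiv; ring.
Qed.

(** * Right helicoids *)

(** Only the lines of [l], [m], [n] matter: a unit vector orthogonal to [l] and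
    [m] is their cross product up to sign, and the sign drops out of products. *)
Lemma orthonormal_parseval (l m n : R3) (Ho : orthonormal l m n) (V W : R3) :
  dot V W = dot V l * dot W l + dot V m * dot W m + dot V n * dot W n.
Proof.
  destruct Ho as (Hl & Hm & Hn & Hlm & Hln & Hmn).
  set (c := cross l m).
  assert (P : forall X Y, dot X Y =
    dot X l * dot Y l + dot X m * dot Y m + dot X c * dot Y c).
  { intros X Y; rewrite (frame_decomposition l m X Hl Hm Hlm) at 1; fold c.
    generalize c; vec_ring. }
  pose proof (P V n) as E1; pose proof (P W n) as E2; pose proof (P n n) as E3.
  rewrite (dot_sym n l), (dot_sym n m), Hln, Hmn in *.
  rewrite (P V W), E1, E2.
  replace (dot V c * dot W c) with (dot V c * dot W c * dot n n)
    by (rewrite Hn; ring).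
  rewrite E3; ring.
Qed.

Lemma in_interval_inhabited a b : Rbar_lt a b -> exists u, in_interval a b u.
Proof.
  unfold in_interval; destruct a as [x | |], b as [y | |]; simpl; intros Hab;
    try contradiction.
  - exists ((x + y) / 2); simpl; lra.
  - exists (x + 1); simpl; split; [lra | exact I].
  - exists (y - 1); simpl; split; [exact I | lra].
  - exists 0; simpl; auto.
Qed.

Lemma in_interval_between a b u w t :
  in_interval a b u -> in_interval a b w -> u <= t <= w -> in_interval a b t.
Proof.
  intros [Hu _] [_ Hw] [H1 H2]; split.
  - eapply Rbar_lt_le_trans; [exact Hu | exact H1].
  - eapply Rbar_le_lt_trans; [| exact Hw]; exact H2.
Qed.

Lemma constant_on_interval a b (f : R -> R) :
  (forall t, in_interval a b t -> is_derive f t 0) ->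
  forall u w, in_interval a b u -> in_interval a b w -> f u = f w.
Proof.
  intros D u w Hu Hw.
  destruct (Rtotal_order u w) as [L | [-> | L]]; [| reflexivity | symmetry];
    apply eq_is_derive; try exact L; intros t Ht; apply D;
    eapply in_interval_between; try exact Ht; assumption.
Qed.

Lemma vconstant_on_interval a b (c : R -> R3) :
  (forall t, in_interval a b t -> is_vderive c t vzero) ->
  forall u w, in_interval a b u -> in_interval a b w -> c u = c w.
Proof.
  intros D u w Hu Hw; apply R3_ext;
    [apply (constant_on_interval a b (fun t => c1 (c t)))
    | apply (constant_on_interval a b (fun t => c2 (c t)))
    | apply (constant_on_interval a b (fun t => c3 (c t)))];
    try assumption; intros t Ht; apply (D t Ht).
Qed.

(** The Frenet equations become [e'' = - e], [z' = 0] and [s' = delta * z] with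
    [delta] constant, so rotating [e] and [n] back by the angle [u] and removing
    the translation along [z] give constant vectors [l], [m], [p]. *)
Lemma helicoid_of_helicoidal a b s e (H : skew_ruled_surface a b s e) :
  (forall u, in_interval a b u -> helicoidal_at s e u) ->
  lies_on_right_helicoid a b (ruled s e).
Proof.
  intros Hh.
  destruct (in_interval_inhabited a b (srs_interval _ _ _ _ H)) as [u0 Hu0].
  set (z := fun u => cross (e u) (vDerive e u)).
  set (l := fun u => vadd (vscal (cos u) (e u)) (vscal (- sin u) (vDerive e u))).
  set (m := fun u => vadd (vscal (sin u) (e u)) (vscal (cos u) (vDerive e u))).
  set (k := distribution s e u0).
  set (p := fun u => vadd (s u) (vscal (- (k * u)) (z u0))).
  assert (DDe : forall t, in_interval a b t ->
    is_vderive (vDerive e) t (vscal (-1) (e t))).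
  { intros t Ht; eapply is_vderive_eq; [exact (proj2 (srs_derive_e a b s e H t Ht)) |].
    rewrite (frame_derivative a b s e H t Ht), (proj1 (Hh t Ht)).
    generalize (e t) (cross (e t) (vDerive e t)); vec_ring. }
  assert (Hz : forall u, in_interval a b u -> z u = z u0).
  { intros u Hu; apply (vconstant_on_interval a b); try assumption.
    intros t Ht; eapply is_vderive_eq.
    - apply is_vderive_cross; [exact (proj1 (srs_derive_e a b s e H t Ht)) | apply (DDe t Ht)].
    - generalize (e t) (vDerive e t); vec_ring. }
  assert (Hl : forall u, in_interval a b u -> l u = l u0).
  { intros u Hu; apply (vconstant_on_interval a b); try assumption.
    intros t Ht; eapply is_vderive_eq.
    - apply is_vderive_add; apply is_vderive_scal.
      + apply is_derive_cos.
      + exact (proj1 (srs_derive_e a b s e H t Ht)).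
      + apply @is_derive_opp, is_derive_sin.
      + apply (DDe t Ht).
    - unfold opp; simpl; generalize (e t) (vDerive e t); vec_ring. }
  assert (Hm : forall u, in_interval a b u -> m u = m u0).
  { intros u Hu; apply (vconstant_on_interval a b); try assumption.
    intros t Ht; eapply is_vderive_eq.
    - apply is_vderive_add; apply is_vderive_scal.
      + apply is_derive_sin.
      + exact (proj1 (srs_derive_e a b s e H t Ht)).
      + apply is_derive_cos.
      + apply (DDe t Ht).
    - generalize (e t) (vDerive e t); vec_ring. }
  assert (Hk : forall u, in_interval a b u -> distribution s e u = k).
  { intros u Hu; apply (constant_on_interval a b); try assumption.
    intros t Ht; eapply is_derive_eq;
      [apply (distribution_rate_correct a b s e H t Ht) | apply (Hh t Ht)]. }
  assert (Hp : forall u, in_interval a b u -> p u = p u0).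
  { intros u Hu; apply (vconstant_on_interval a b); try assumption.
    intros t Ht; eapply is_vderive_eq.
    - apply is_vderive_add; [exact (proj1 (srs_derive_s a b s e H t Ht)) |].
      apply (is_vderive_scal (fun w => - (k * w)) _ _ (- k));
        [auto_derive; [exact I | ring] | apply is_vderive_const].
    - rewrite (striction_derivative a b s e H t Ht).
      destruct (Hh t Ht) as (_ & -> & _).
      rewrite (Hk t Ht); fold (z t); rewrite (Hz t Ht).
      generalize (z u0) (e t); vec_ring. }
  exists (p u0), (l u0), (m u0), (z u0), k; split; [| split].
  - destruct (frame_relations a b s e H u0 Hu0) as (HE & HN & HEN).
    pose proof (sin2_cos2 u0) as Hsc; unfold Rsqr in Hsc.
    unfold l, m, z; set (E := e u0) in *; set (N := vDerive e u0) in *.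
    set (S := sin u0) in *; set (C := cos u0) in *; clearbody E N S C.
    unfold orthonormal; repeat split.
    + transitivity (C * C * dot E E + S * S * dot N N - 2 * S * C * dot E N);
        [vec_ring | rewrite HE, HN, HEN; lra].
    + transitivity (S * S * dot E E + C * C * dot N N + 2 * S * C * dot E N);
        [vec_ring | rewrite HE, HN, HEN; lra].
    + transitivity (dot E E * dot N N - dot E N * dot E N);
        [vec_ring | rewrite HE, HN, HEN; lra].
    + transitivity (C * S * (dot E E - dot N N) + (C * C - S * S) * dot E N);
        [vec_ring | rewrite HE, HN, HEN; lra].
    + vec_ring.
    + vec_ring.
  - exact (srs_skew _ _ _ _ H u0 Hu0).
  - intros u v Hu; exists v, u.
    rewrite <- (Hl u Hu), <- (Hm u Hu), <- (Hp u Hu).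
    pose proof (sin2_cos2 u) as Hsc; unfold Rsqr in Hsc.
    unfold p, l, m, ruled.
    transitivity (vadd (s u) (vscal (v * (sin u * sin u + cos u * cos u)) (e u))).
    + rewrite Hsc; vec_ring.
    + generalize (s u) (e u) (vDerive e u) (z u0) (sin u) (cos u); vec_ring.
Qed.

Lemma is_derive_dot_const c t d q :
  is_vderive c t d -> is_derive (fun w => dot (c w) q) t (dot d q).
Proof.
  intros D; eapply is_derive_eq.
  - apply (is_derive_dot c (fun _ => q)); [exact D | apply is_vderive_const].
  - generalize (c t); vec_ring.
Qed.

(** Eliminates the two parameters of the helicoid. The result is an equation that
    can be differentiated along curves on the surface, although the angle given by
    [right_helicoid] need not be a continuous function of the point. *)
Lemma right_helicoid_equation p l m n k z (Ho : orthonormal l m n) (Hk : k <> 0) :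
  right_helicoid p l m n k z ->
  (dot z l - dot p l) * sin ((dot z n - dot p n) / k) =
  (dot z m - dot p m) * cos ((dot z n - dot p n) / k).
Proof.
  destruct Ho as (Hl & Hm & Hn & Hlm & Hln & Hmn).
  intros (r & phi & ->).
  set (z := vadd p _).
  assert (El : dot z l - dot p l = r * cos phi).
  { unfold z; transitivity (r * cos phi * dot l l + r * sin phi * dot l m
      + k * phi * dot l n); [generalize (cos phi) (sin phi); vec_ring |].
    rewrite Hl, Hlm, Hln; ring. }
  assert (Em : dot z m - dot p m = r * sin phi).
  { unfold z; transitivity (r * cos phi * dot l m + r * sin phi * dot m m
      + k * phi * dot m n); [generalize (cos phi) (sin phi); vec_ring |].
    rewrite Hm, Hlm, Hmn; ring. }
  assert (En : dot z n - dot p n = k * phi).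
  { unfold z; transitivity (r * cos phi * dot l n + r * sin phi * dot m n
      + k * phi * dot n n); [generalize (cos phi) (sin phi); vec_ring |].
    rewrite Hn, Hln, Hmn; ring. }
  rewrite El, Em, En; replace (k * phi / k) with phi by (field; exact Hk); ring.
Qed.

(** Along a line transversal to the horizontal planes the angle takes the values
    [0, PI] and [- PI / 2, PI / 2], at each of which one of the two horizontal
    coordinates vanishes. *)
Lemma oblique_line_on_helicoid (sl sm sn el em en k : R) : k <> 0 -> en <> 0 ->
  (forall v, (sl + v * el) * sin ((sn + v * en) / k) =
             (sm + v * em) * cos ((sn + v * en) / k)) ->
  el = 0 /\ em = 0.
Proof.
  intros Hk Hen HF.
  assert (HF' : forall t, (sl + (k * t - sn) / en * el) * sin t =
                          (sm + (k * t - sn) / en * em) * cos t).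
  { intros t; pose proof (HF ((k * t - sn) / en)) as Ht.
    replace ((sn + (k * t - sn) / en * en) / k) with t in Ht by (field; auto).
    exact Ht. }
  assert (Z : forall t e0 s0, t <> 0 ->
    s0 + (k * t - sn) / en * e0 = 0 -> s0 + (k * 0 - sn) / en * e0 = 0 -> e0 = 0).
  { intros t e0 s0 Ht A B.
    assert (C : k * t * e0 = 0).
    { apply (quotient_zero _ en Hen).
      transitivity ((s0 + (k * t - sn) / en * e0) - (s0 + (k * 0 - sn) / en * e0)).
      - field; exact Hen.
      - rewrite A, B; ring. }
    apply Rmult_integral in C; destruct C as [C | C]; [| exact C].
    apply Rmult_integral in C; tauto. }
  pose proof PI_RGT_0 as HPI.
  pose proof (HF' 0) as F0; pose proof (HF' PI) as F1.
  pose proof (HF' (PI / 2)) as F2; pose proof (HF' (- (PI / 2))) as F3.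
  rewrite sin_0, cos_0 in F0; rewrite sin_PI, cos_PI in F1.
  rewrite sin_PI2, cos_PI2 in F2; rewrite sin_neg, cos_neg, sin_PI2, cos_PI2 in F3.
  split.
  - assert (C : k * PI * el = 0).
    { apply (quotient_zero _ en Hen).
      transitivity ((sl + (k * (PI / 2) - sn) / en * el)
        - (sl + (k * - (PI / 2) - sn) / en * el)); [field; exact Hen | lra]. }
    apply Rmult_integral in C; destruct C as [C | C]; [| exact C].
    apply Rmult_integral in C; destruct C; [contradiction | lra].
  - apply (Z PI em sm); lra.
Qed.

(** The rulings are horizontal, so [z] is parallel to the axis and [kappa = 0].
    The height [S n] turns the ruling by the angle [theta = S n / k]. As [e] has
    unit speed, [theta' = 1] or [theta' = - 1], whence [delta^2 = k^2] and
    [delta' = 0]. Differentiating the helicoid equation along [s] shows that the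
    line of striction is the axis; its tangent is then parallel to [z], so
    [delta * lambda = 0]. *)
Lemma helicoidal_of_helicoid a b s e (H : skew_ruled_surface a b s e) :
  lies_on_right_helicoid a b (ruled s e) ->
  forall u, in_interval a b u -> helicoidal_at s e u.
Proof.
  intros (p & l & m & n & k & Ho & Hk & Hx).
  set (S := fun q u => dot (s u) q - dot p q).
  set (E := fun q u => dot (e u) q).
  assert (HF : forall u v, in_interval a b u ->
    (S l u + v * E l u) * sin ((S n u + v * E n u) / k) =
    (S m u + v * E m u) * cos ((S n u + v * E n u) / k)).
  { intros u v Hu.
    assert (Q : forall q, S q u + v * E q u = dot (ruled s e u v) q - dot p q).
    { intros q; unfold S, E, ruled; generalize (s u) (e u); vec_ring. }
    rewrite !Q; apply right_helicoid_equation; auto. }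
  assert (DS : forall q u, in_interval a b u -> is_derive (S q) u (dot (vDerive s u) q)).
  { intros q u Hu; eapply is_derive_eq.
    - apply is_derive_Rminus;
        [exact (is_derive_dot_const _ _ _ q (proj1 (srs_derive_s a b s e H u Hu)))
        | apply @is_derive_const].
    - unfold zero; simpl; ring. }
  assert (DE : forall q u, in_interval a b u -> is_derive (E q) u (dot (vDerive e u) q)).
  { intros q u Hu; exact (is_derive_dot_const _ _ _ q (proj1 (srs_derive_e a b s e H u Hu))). }
  pose proof (orthonormal_parseval l m n Ho) as Pv.
  (* The rulings are horizontal: an oblique one would be the axis, and so would
     its neighbours, whereas the direction of the rulings has unit speed. *)
  assert (HEn : forall u, in_interval a b u -> E n u = 0).
  { intros u Hu; destruct (Req_dec (E n u) 0) as [| Hen]; [assumption | exfalso].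
    assert (L : locally u (fun w => E l w = 0 /\ E m w = 0)).
    { assert (C : locally u (fun w => E n w <> 0)).
      { assert (Cn : continuous (E n) u).
        { apply (ex_derive_continuous (E n) u); eexists; exact (DE n u Hu). }
        apply (Cn (fun y => y <> 0)), (open_neq 0 (E n u)), Hen. }
      generalize (filter_and _ _ C (locally_interval a b u Hu)).
      apply filter_imp; intros w [Cw Iw].
      apply (oblique_line_on_helicoid (S l w) (S m w) (S n w) (E l w) (E m w) (E n w) k);
        auto. }
    assert (A : forall q, locally u (fun w => E q w = 0) -> dot (vDerive e u) q = 0).
    { intros q Lq; rewrite <- (is_derive_unique _ _ _ (DE q u Hu)).
      rewrite (Derive_ext_loc _ (fun _ => 0) u Lq); apply Derive_const. }
    assert (Al : dot (vDerive e u) l = 0)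
      by (apply A; revert L; apply filter_imp; tauto).
    assert (Am : dot (vDerive e u) m = 0)
      by (apply A; revert L; apply filter_imp; tauto).
    destruct (frame_relations a b s e H u Hu) as (_ & HN & HEN).
    rewrite Pv, Al, Am in HN, HEN; fold (E n u) in HEN.
    assert (dot (vDerive e u) n = 0) by (apply (Rmult_eq_reg_l (E n u)); lra).
    nra. }
  assert (HNn : forall u, in_interval a b u -> dot (vDerive e u) n = 0).
  { intros u Hu; rewrite <- (is_derive_unique _ _ _ (DE n u Hu)).
    apply is_derive_unique.
    apply (is_derive_on_interval a b u (fun _ => 0));
      [exact Hu | intros; symmetry; auto | apply @is_derive_const]. }
  assert (Hzn : forall u, in_interval a b u ->
    let z := cross (e u) (vDerive e u) in
    dot z n ^ 2 = 1 /\ dot z l = 0 /\ dot z m = 0).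
  { intros u Hu z.
    destruct (frame_relations a b s e H u Hu) as (HE & HN & HEN).
    assert (Hz : dot z z = 1).
    { transitivity (dot (e u) (e u) * dot (vDerive e u) (vDerive e u)
        - dot (e u) (vDerive e u) * dot (e u) (vDerive e u)).
      - unfold z; generalize (e u) (vDerive e u); vec_ring.
      - rewrite HE, HN, HEN; ring. }
    assert (Hn : dot z n ^ 2 = 1).
    { assert (Hfr : orthonormal (e u) (vDerive e u) z).
      { repeat split; auto; unfold z; generalize (e u) (vDerive e u); vec_ring. }
      pose proof (orthonormal_parseval _ _ _ Hfr n n) as Hnn.
      destruct Ho as (_ & _ & Hn1 & _).
      rewrite Hn1, !(dot_sym n) in Hnn; rewrite (HNn u Hu) in Hnn.
      pose proof (HEn u Hu) as Hen; unfold E in Hen; rewrite Hen in Hnn.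
      lra. }
    split; [exact Hn |].
    rewrite Pv in Hz; split; nra. }
  (* The horizontal ruling at angle [theta] points in the direction
     [sigma * (cos theta, sin theta)] with [sigma ^ 2 = 1]. *)
  set (theta := fun u => S n u / k).
  set (sigma := fun u => E l u * cos (theta u) + E m u * sin (theta u)).
  set (rate := fun u => dot (vDerive s u) n / k).
  assert (Dt : forall u, in_interval a b u -> is_derive theta u (rate u)).
  { intros u Hu; unfold theta, rate, Rdiv; eapply is_derive_eq.
    - apply is_derive_Rmult; [apply (DS n u Hu) | apply @is_derive_const].
    - unfold zero; simpl; ring. }
  assert (FS : forall u, in_interval a b u ->
    S l u * sin (theta u) - S m u * cos (theta u) = 0).
  { intros u Hu; pose proof (HF u 0 Hu) as F.
    rewrite !Rmult_0_l, !Rplus_0_r in F; fold (theta u) in F; lra. }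
  assert (FE : forall u, in_interval a b u ->
    E l u * sin (theta u) - E m u * cos (theta u) = 0).
  { intros u Hu; pose proof (HF u 1 Hu) as F; rewrite (HEn u Hu) in F.
    rewrite Rmult_0_r, Rplus_0_r in F; fold (theta u) in F.
    pose proof (FS u Hu); lra. }
  (* Differentiates the helicoid equation, for [S] and for [E] alike. *)
  assert (DF : forall (f g : R -> R) (df dg : R) u, in_interval a b u ->
    is_derive f u df -> is_derive g u dg ->
    (forall w, in_interval a b w -> f w * sin (theta w) - g w * cos (theta w) = 0) ->
    df * sin (theta u) - dg * cos (theta u)
      + rate u * (f u * cos (theta u) + g u * sin (theta u)) = 0).
  { intros f g df dg u Hu Df Dg Hfg.
    assert (Ds : is_derive (fun w => sin (theta w)) u (rate u * cos (theta u))).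
    { apply (is_derive_comp sin); [apply is_derive_sin | apply (Dt u Hu)]. }
    assert (Dc : is_derive (fun w => cos (theta w)) u (rate u * - sin (theta u))).
    { apply (is_derive_comp cos); [apply is_derive_cos | apply (Dt u Hu)]. }
    pose proof (is_derive_Rminus _ _ _ _ _
      (is_derive_Rmult _ _ _ _ _ Df Ds) (is_derive_Rmult _ _ _ _ _ Dg Dc)) as D.
    apply (is_derive_on_interval a b u _ (fun _ => 0)) in D; auto.
    apply is_derive_unique in D; rewrite Derive_const in D.
    cbv beta in D; lra. }
  assert (Hsc : forall u, sin (theta u) * sin (theta u) + cos (theta u) * cos (theta u) = 1)
    by (intros u; exact (sin2_cos2 (theta u))).
  assert (Esig : forall u, in_interval a b u ->
    E l u = sigma u * cos (theta u) /\ E m u = sigma u * sin (theta u) /\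
    sigma u ^ 2 = 1).
  { intros u Hu.
    destruct (frame_relations a b s e H u Hu) as (HE & _ & _).
    rewrite Pv in HE; fold (E l u) (E m u) (E n u) in HE; rewrite (HEn u Hu) in HE.
    pose proof (FE u Hu) as F; pose proof (Hsc u) as T; unfold sigma.
    set (C := cos (theta u)) in *; set (D := sin (theta u)) in *.
    set (A := E l u) in *; set (B := E m u) in *.
    split3.
    - transitivity (A * (D * D + C * C) - D * (A * D - B * C)); [rewrite T, F | ]; ring.
    - transitivity (B * (D * D + C * C) + C * (A * D - B * C)); [rewrite T, F | ]; ring.
    - transitivity ((A * A + B * B) * (D * D + C * C) - (A * D - B * C) ^ 2);
        [ring | rewrite T, F]; lra. }
  assert (Hrate : forall u, in_interval a b u -> rate u ^ 2 = 1).
  { intros u Hu.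
    destruct (frame_relations a b s e H u Hu) as (_ & HN & HEN).
    rewrite Pv, (HNn u Hu) in HN, HEN; fold (E l u) (E m u) (E n u) in HEN.
    pose proof (DF _ _ _ _ u Hu (DE l u Hu) (DE m u Hu) FE) as F.
    fold (sigma u) in F.
    destruct (Esig u Hu) as (El & Em & Hs); rewrite El, Em in HEN.
    pose proof (Hsc u) as T.
    set (C := cos (theta u)) in *; set (D := sin (theta u)) in *.
    set (A := dot (vDerive e u) l) in *; set (B := dot (vDerive e u) m) in *.
    assert (G : A * C + B * D = 0).
    { transitivity (sigma u ^ 2 * (A * C + B * D)); [rewrite Hs; ring |].
      transitivity (sigma u * (sigma u * C * A + sigma u * D * B + E n u * 0)); [ring |].
      rewrite HEN; ring. }
    transitivity ((rate u * sigma u) ^ 2); [rewrite Rpow_mult_distr, Hs; ring |].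
    replace (rate u * sigma u) with (- (A * D - B * C)) by lra.
    transitivity ((A * A + B * B + 0 * 0) * (D * D + C * C) - (A * C + B * D) ^ 2); [ring |].
    rewrite T, G, HN; ring. }
  assert (Hd2 : forall u, in_interval a b u -> distribution s e u ^ 2 = k ^ 2).
  { intros u Hu.
    destruct (Hzn u Hu) as (Hz & _ & _).
    assert (Hr : rate u * k = distribution s e u * dot (cross (e u) (vDerive e u)) n).
    { unfold rate; rewrite (striction_derivative a b s e H u Hu).
      transitivity (striction_slope s e u * E n u
        + distribution s e u * dot (cross (e u) (vDerive e u)) n).
      - unfold E; generalize (e u) (cross (e u) (vDerive e u)); intros E0 z.
        transitivity (dot (vadd (vscal (striction_slope s e u) E0)
          (vscal (distribution s e u) z)) n); [field; exact Hk | vec_ring].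
      - rewrite (HEn u Hu); ring. }
    transitivity ((rate u * k) ^ 2); rewrite ?Hr, Rpow_mult_distr.
    - rewrite Hz; ring.
    - rewrite <- Rpow_mult_distr, <- Hr, Rpow_mult_distr, (Hrate u Hu); ring. }
  assert (HS0 : forall u, in_interval a b u -> S l u = 0 /\ S m u = 0).
  { intros u Hu.
    pose proof (DF _ _ _ _ u Hu (DS l u Hu) (DS m u Hu) FS) as F.
    destruct (Hzn u Hu) as (_ & Zl & Zm).
    assert (Hs' : forall q, dot (cross (e u) (vDerive e u)) q = 0 ->
      dot (vDerive s u) q = striction_slope s e u * E q u).
    { intros q Hq; rewrite (striction_derivative a b s e H u Hu).
      transitivity (striction_slope s e u * E q u
        + distribution s e u * dot (cross (e u) (vDerive e u)) q).
      - unfold E; generalize (e u) (cross (e u) (vDerive e u)); vec_ring.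
      - rewrite Hq; ring. }
    rewrite (Hs' l Zl), (Hs' m Zm) in F.
    pose proof (FE u Hu) as G; pose proof (FS u Hu) as G'; pose proof (Hsc u) as T.
    pose proof (Hrate u Hu) as Hr.
    set (C := cos (theta u)) in *; set (D := sin (theta u)) in *.
    set (A := S l u) in *; set (B := S m u) in *.
    assert (K : A * C + B * D = 0).
    { assert (K : rate u * (A * C + B * D) = 0).
      { transitivity (striction_slope s e u * E l u * D - striction_slope s e u * E m u * C
          + rate u * (A * C + B * D) - striction_slope s e u * (E l u * D - E m u * C));
          [ring | rewrite F, G; ring]. }
      transitivity (rate u ^ 2 * (A * C + B * D)); [rewrite Hr; ring |].
      transitivity (rate u * (rate u * (A * C + B * D))); [ring | rewrite K; ring]. }
    split.
    - transitivity (A * (D * D + C * C)); [rewrite T; ring |].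
      transitivity (C * (A * C + B * D) + D * (A * D - B * C)); [ring |].
      rewrite K, G'; ring.
    - transitivity (B * (D * D + C * C)); [rewrite T; ring |].
      transitivity (D * (A * C + B * D) - C * (A * D - B * C)); [ring |].
      rewrite K, G'; ring. }
  intros u Hu; destruct (Hzn u Hu) as (Zn & Zl & Zm).
  split3.
  - assert (A : dot (vDerive (vDerive e) u) n = 0).
    { pose proof (is_derive_dot_const _ _ _ n (proj2 (srs_derive_e a b s e H u Hu))) as D.
      apply (is_derive_on_interval a b u _ (fun _ => 0)) in D; auto.
      apply is_derive_unique in D; rewrite Derive_const in D; auto. }
    rewrite (frame_derivative a b s e H u Hu) in A.
    assert (B : conical_curvature e u * dot (cross (e u) (vDerive e u)) n = 0).
    { rewrite <- A; transitivity (- 1 * E n u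
        + conical_curvature e u * dot (cross (e u) (vDerive e u)) n).
      - rewrite (HEn u Hu); ring.
      - unfold E; generalize (e u) (cross (e u) (vDerive e u)); vec_ring. }
    apply Rmult_integral in B; destruct B as [B | B]; [exact B |].
    rewrite B in Zn; lra.
  - assert (A : forall q, (forall w, in_interval a b w -> S q w = 0) ->
      dot (cross (e u) (vDerive e u)) q = 0 -> striction_slope s e u * E q u = 0).
    { intros q Hq Hzq.
      pose proof (DS q u Hu) as D.
      apply (is_derive_on_interval a b u _ (fun _ => 0)) in D; auto.
      apply is_derive_unique in D; rewrite Derive_const in D.
      rewrite (striction_derivative a b s e H u Hu) in D; rewrite D.
      transitivity (striction_slope s e u * E q u
        + distribution s e u * dot (cross (e u) (vDerive e u)) q).
      - rewrite Hzq; ring.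
      - unfold E; generalize (e u) (cross (e u) (vDerive e u)); vec_ring. }
    pose proof (A l (fun w Hw => proj1 (HS0 w Hw)) Zl) as Al.
    pose proof (A m (fun w Hw => proj2 (HS0 w Hw)) Zm) as Am.
    destruct (Esig u Hu) as (_ & _ & Hs).
    assert (B : striction_slope s e u * sigma u = 0).
    { unfold sigma; transitivity (striction_slope s e u * E l u * cos (theta u)
        + striction_slope s e u * E m u * sin (theta u)); [ring |].
      rewrite Al, Am; ring. }
    apply Rmult_integral in B; destruct B as [B | B]; [exact B |].
    rewrite B in Hs; lra.
  - pose proof (distribution_rate_correct a b s e H u Hu) as D.
    pose proof (is_derive_Rmult _ _ _ _ _ D D) as D2.
    apply (is_derive_on_interval a b u _ (fun _ => k ^ 2)) in D2; auto.
    2: { intros w Hw; rewrite <- (Hd2 w Hw); ring. }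
    apply is_derive_unique in D2; rewrite Derive_const in D2.
    pose proof (srs_skew _ _ _ _ H u Hu) as Hd.
    apply (Rmult_eq_reg_l (distribution s e u)); [lra | exact Hd].
Qed.

Theorem proposition2 (a b : Rbar) (s e : R -> R3) (alpha : R)
    (Hsurf : skew_ruled_surface a b s e) (Halpha : alpha <> 1 / 4) :
  let x := ruled s e in
  let y := manhart_normalization x alpha in
  let property_i :=
    tangent_curved_asymptotic_lines a b x (tchebychev x y) \/
    tangent_striction_distance_curves a b x (tchebychev x y) \/
    tangent_K_curves a b x (tchebychev_up x y) in
  let property_ii := forall u v : R, in_interval a b u -> pick x y u v = 0 in
  let property_iii := lies_on_right_helicoid a b x in
  (property_i <-> property_ii) /\ (property_ii <-> property_iii).
Proof.
  intros x y property_i property_ii property_iii.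
  assert (Hi : property_i <-> forall u, in_interval a b u -> helicoidal_at s e u).
  { split.
    - exact (helicoidal_of_tangent a b s e alpha Hsurf Halpha).
    - intros Hh; right; left; exact (tangent_of_helicoidal a b s e alpha Hsurf Hh). }
  assert (Hii : property_ii <-> forall u, in_interval a b u -> helicoidal_at s e u).
  { exact (pick_zero_iff_helicoidal a b s e alpha Hsurf Halpha). }
  assert (Hiii : property_iii <-> forall u, in_interval a b u -> helicoidal_at s e u).
  { split; [apply helicoidal_of_helicoid | apply helicoid_of_helicoidal]; exact Hsurf. }
  rewrite Hi, Hii, Hiii; split; reflexivity.
Qed.
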